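(* Let $c_0\in(0,1/2)$. There exists a constant $c>0$, depending only on $c_0$ (and not on $n,\alpha,d,r$), such that for all integers $n\ge1$, $d\ge2$, $1\le r\le d$ and all $\alpha\in(0,\tfrac12-c_0]$, $$\inf_{(M,\hat\rho)}\ \sup_{\rho\in\mathcal S_r(\mathbb C^d)}\mathbb E_\rho\big[\|\hat\rho-\rho\|_F^2\big]\ \ge\ c\,\min\Big\{\varphi(d,r),\ \frac{d^2r}{n\alpha^2}\Big\},$$ where the infimum is over all locally-$\alpha$-gentle measurements $M$ of $\rho^{\otimes n}$ and all subsequent estimators $\hat\rho$ (functions of the measurement outcome), and where $$\varphi(d,r)=\begin{cases}\frac18 & r=1\ (\text{pure states}),\\[2pt] \frac1{4d^3r^5} & 1<r<d/2,\\[2pt] \frac1{4d^2} & r>1,\ r\ge d/2.\end{cases}$$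
   Context: $\mathcal S(\mathbb C^d)$ is the set of density matrices (positive semidefinite, trace 1) on $\mathbb C^d$; $\mathcal S_r(\mathbb C^d)$ the subset of those of rank $r$. A measurement on $\mathbb C^d$ is a countable family $M=(M_\omega)_{\omega\in\Omega}$ of matrices in $\mathbb C^{d\times d}$ with $\sum_\omega M_\omega^*M_\omega=\mathbb 1$; put $E_\omega=M_\omega^*M_\omega$. Measuring $\rho$ yields a random outcome $R^M$ with $\mathbb P_\rho(R^M=\omega)=\operatorname{Tr}[\rho E_\omega]$ and, if this is positive, the post-measurement state $\rho_{M\to\omega}=M_\omega\rho M_\omega^*/\operatorname{Tr}[\rho E_\omega]$. With $\|A\|_{Tr}=\frac12\operatorname{Tr}|A|$, $M$ is $\alpha$-gentle on $\mathcal S(\mathbb C^d)$ if $\|\rho-\rho_{M\to\omega}\|_{Tr}\le\alpha$ for all $\rho\in\mathcal S(\mathbb C^d)$ and all outcomes $\omega$ (of positive probability). A locally-$\alpha$-gentle measurement on $n$ systems is a product measurement $M=M_1\otimes\dots\otimes M_n$ (operators $M_{1,\omega_1}\otimes\dots\otimes M_{n,\omega_n}$, applied to $\rho^{\otimes n}$) in which each $M_i$ is $\alpha$-gentle on $\mathcal S(\mathbb C^d)$. An estimator is a map $\hat\rho$ from the outcome space $\Omega_1\times\dots\times\Omega_n$ to $\mathcal S(\mathbb C^d)$. $\|\cdot\|_F$ is the Frobenius norm. *)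

(* Defs.v *)
From mathcomp Require Import all_boot all_order all_algebra.
From mathcomp Require Import all_classical all_reals all_analysis.
From mathcomp Require Import complex.
From mathcomp Require summability.

Set Implicit Arguments.
Unset Strict Implicit.
Unset Printing Implicit Defensive.

Import Order.TTheory GRing.Theory Num.Theory.
Import numFieldNormedType.Exports.

Local Open Scope classical_set_scope.
Local Open Scope ring_scope.
Local Open Scope complex_scope.
Local Open Scope sesquilinear_scope.

Section Matrices.
Variable R : realType.

Definition psdmx d (A : 'M[R[i]]_d) : Prop :=
  A \is hermsymmx /\ forall v : 'cV[R[i]]_d, 0 <= (v ^t* *m A *m v) 0 0.

Definition density_mx d (rho : 'M[R[i]]_d) : Prop :=
  psdmx rho /\ \tr rho = 1.

Definition density_mx_rank d r (rho : 'M[R[i]]_d) : Prop :=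
  density_mx rho /\ \rank rho = r.

(* Square root by functional calculus; meaningful for positive semidefinite A. *)
Definition sqrtmx d (A : 'M[R[i]]_d) : 'M[R[i]]_d :=
  invmx (spectralmx A) *m diag_mx (map_mx sqrtC (spectral_diag A))
    *m spectralmx A.

Definition absmx d (A : 'M[R[i]]_d) : 'M[R[i]]_d := sqrtmx (A ^t* *m A).

(* \tr (absmx A) is a nonnegative real, so taking Re loses nothing;
   note the normalisation by 1/2. *)
Definition trace_norm d (A : 'M[R[i]]_d) : R := complex.Re (\tr (absmx A)) / 2.

Definition frobenius_norm d (A : 'M[R[i]]_d) : R :=
  Num.sqrt (\sum_i \sum_j (Normc.normc (A i j)) ^+ 2).

(* The n-fold tensor product, as an operator on (C^d)^{(x) n} whose canonical
   basis is indexed by the multi-indices {ffun 'I_n -> 'I_d}. *)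
Definition tensor_mx n d (A : 'I_n -> 'M[R[i]]_d) :
    'M[R[i]]_#|{ffun 'I_n -> 'I_d}| :=
  \matrix_(a, b) \prod_(i < n)
    A i ((enum_val a : {ffun 'I_n -> 'I_d}) i)
        ((enum_val b : {ffun 'I_n -> 'I_d}) i).

End Matrices.

Section Measurements.
Variable R : realType.

Record op_family (d : nat) := OpFamily {
  outcome : countType;
  op : outcome -> 'M[R[i]]_d }.

Definition effect d (M : op_family d) (w : outcome M) : 'M[R[i]]_d :=
  (op w) ^t* *m op w.

(* Unconditional convergence: the net of finite partial sums over
   {fset outcome M} tends to the identity. The alias R[i]^o carries the usual
   topology of the complex plane. *)
Definition is_measurement d (M : op_family d) : Prop :=
  summability.partial_sum (fun w : outcome M => effect w : 'M[R[i]^o]_d)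
    @ summability.totally --> (1%:M : 'M[R[i]^o]_d).

Definition outcome_prob d (M : op_family d) (rho : 'M[R[i]]_d)
    (w : outcome M) : R :=
  complex.Re (\tr (rho *m effect w)).

Definition post_state d (M : op_family d) (rho : 'M[R[i]]_d)
    (w : outcome M) : 'M[R[i]]_d :=
  (outcome_prob rho w)^-1%:C *: (op w *m rho *m (op w) ^t*).

Definition gentle d (alpha : R) (M : op_family d) : Prop :=
  forall rho : 'M[R[i]]_d, density_mx rho ->
  forall w : outcome M, 0 < outcome_prob rho w ->
  trace_norm (rho - post_state rho w) <= alpha.

Definition tensor_family n d (M : 'I_n -> op_family d) :
    op_family #|{ffun 'I_n -> 'I_d}| :=
  @OpFamily _ {dffun forall i : 'I_n, outcome (M i)}
    (fun w => tensor_mx (fun i => op (w i))).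

Definition locally_gentle n d (alpha : R) (M : 'I_n -> op_family d) : Prop :=
  forall i, is_measurement (M i) /\ gentle alpha (M i).

Definition risk n d (M : 'I_n -> op_family d)
    (est : outcome (tensor_family M) -> 'M[R[i]]_d) (rho : 'M[R[i]]_d) : \bar R :=
  \esum_(w in [set: outcome (tensor_family M)])
    (outcome_prob (tensor_mx (fun _ : 'I_n => rho)) w
       * frobenius_norm (est w - rho) ^+ 2)%:E.

Definition minimax_risk (n d r : nat) (alpha : R) : \bar R :=
  ereal_inf [set x | exists (M : 'I_n -> op_family d)
      (est : outcome (tensor_family M) -> 'M[R[i]]_d),
    [/\ locally_gentle alpha M, forall w, density_mx (est w)
      & x = ereal_sup [set risk est rho | rho in density_mx_rank r]]].

End Measurements.

Definition rate_cap (R : realType) (d r : nat) : R :=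
  if r == 1%N then 1 / 8
  else if (r.*2 < d)%N then 1 / (4 * d%:R ^+ 3 * r%:R ^+ 5)
  else 1 / (4 * d%:R ^+ 2).

(* Main.v *)
Require Import Defs.
From mathcomp Require Import all_boot all_order all_algebra.
From mathcomp Require Import all_classical all_reals all_analysis.
From mathcomp Require Import zify complex finmap ring lra.

(** Why the bound holds.

Gentleness flattens effects. Let E be an effect of an alpha-gentle
measurement, x and y orthonormal, l^2 and m^2 the probabilities that E gives
them. Measuring the mixture q x x^* + (1 - q) y y^* reweights q to
q l^2 / (q l^2 + (1 - q) m^2), up to an error alpha because the post-measurement
state of x is still alpha-close to x. The trace distance allows only an
alpha-small change of the weight, and the choice q = m / (l + m) turns this
into l - m <= 2 alpha (l + m) (gentle_two_point). Applied to eigenvectors of E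
this gives E = mu (1 + O(alpha)) in operator norm, with mu the least eigenvalue
(gentle_effect). The constant is finite because alpha stays away from 1/2.

A hypercube of rank r states. With m = min(r, floor(d/2)), the vectors
e_k + delta sum_(a >= m) (+- e_a) for k < m and e_k for m <= k < r are linearly
independent whatever the m (d - m) signs are, and their squared lengths do not
depend on the signs; the sum of v v^* over these vectors v, divided by its trace,
is a state of rank r. Each sign is read off one entry of its lower left block.
Flipping it changes the probability of E by delta / r times an entry of (E - mu)
applied to a frame vector, up to constants and a diagonal correction, so the sum over all
m (d - m) signs of the squared changes is controlled by m squared lengths
||(E - mu) v||^2 = O(alpha^2 mu^2) (frame_info). Since there are about d r signs,
each one is hidden on average by the factor 1 / d: this is where d^2 r rather
than d r comes from.

Assouad's lemma. For a product measurement the Hellinger affinity of the laws of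
the outcomes is a product over the n systems, hence at least 1 minus the sum of
the n single-system informations (assouad_product). With
delta^2 = min(1 / d, const d r^2 / (n alpha^2)) most signs cannot be detected,
and each undetected sign costs (delta / r)^2 in squared Frobenius distance. The
outcome of a measurement ranges over a countable set; finitely many outcomes
carry almost all the probability uniformly over the hypercube
(measurement_truncation), and dropping the other ones only lowers the risk, so
that the argument involves finite sums only. The bound obtained is of order
min(1 / r, d^2 r / (n alpha^2)), and each of the three expressions of the cap is
at most 1 / r (rate_cap_le). *)

Set Implicit Arguments.
Unset Strict Implicit.
Unset Printing Implicit Defensive.

Import Order.TTheory GRing.Theory Num.Theory.
Local Open Scope ring_scope.

(** * Hellinger affinity and Assouad's lemma *)

Section Affinity.
Variable R : realType.

(** The value x serves as a guess between h (weight a) and -h (weight b). With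
p = sqrt a and q = sqrt b the difference of the two sides is a sum of two
squares. *)
Lemma two_point_bound (a b x h : R) : 0 <= a -> 0 <= b ->
  h ^+ 2 * (4 * Num.sqrt (a * b) - (a + b)) <=
  a * (x - h) ^+ 2 + b * (x + h) ^+ 2.
Proof.
move=> a0 b0; rewrite sqrtrM //.
rewrite -{2 3}(sqr_sqrtr a0) -{2 3}(sqr_sqrtr b0).
set p := Num.sqrt a; set q := Num.sqrt b.
rewrite -subr_ge0 [leRHS](_ : _ =
  (p * x - h * (p - q)) ^+ 2 + (q * x - h * (p - q)) ^+ 2); last by ring.
by rewrite addr_ge0 ?sqr_ge0.
Qed.

(** The harmonic mean is at most the geometric mean; subtracting the former from
the arithmetic mean leaves the chi-square-like term. With the quotient by zero
equal to zero this also holds for a = b = 0. *)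
Lemma sqrtM_ge (a b : R) : 0 <= a -> 0 <= b ->
  (a + b) / 2 - (a - b) ^+ 2 / (a + b) / 2 <= Num.sqrt (a * b).
Proof.
move=> a0 b0; have [s0|] := eqVneq (a + b) 0.
  by rewrite s0 invr0 !(mul0r, mulr0) subr0 sqrtr_ge0.
rewrite neq_lt ltNge addr_ge0 //= => s0.
rewrite sqrtrM //; rewrite -(sqr_sqrtr a0) -(sqr_sqrtr b0) in s0 *.
rewrite !sqrtr_sqr !ger0_norm ?sqrtr_ge0 //.
set p := Num.sqrt a in s0 *; set q := Num.sqrt b in s0 *.
have pq : 0 <= p * q by rewrite mulr_ge0 ?sqrtr_ge0.
suff : (p - q) ^+ 2 <= (p ^+ 2 - q ^+ 2) ^+ 2 / (p ^+ 2 + q ^+ 2) by lra.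
rewrite ler_pdivlMr // -subr_ge0.
rewrite [leRHS](_ : _ = 2 * ((p - q) ^+ 2 * (p * q))); last by ring.
by rewrite mulr_ge0 // mulr_ge0 ?sqr_ge0.
Qed.

Lemma sqrtr_prod (I : finType) (f : I -> R) : (forall i, 0 <= f i) ->
  Num.sqrt (\prod_i f i) = \prod_i Num.sqrt (f i).
Proof.
move=> f0.
suff : 0 <= \prod_i f i /\ Num.sqrt (\prod_i f i) = \prod_i Num.sqrt (f i) by case.
elim/big_rec2: _ => [|i y z _ [z0 <-]]; first by rewrite ler01 sqrtr1.
by rewrite mulr_ge0 // sqrtrM.
Qed.

Lemma prod_ge_subsum (I : finType) (x : I -> R) :
  (forall i, 0 <= x i <= 1) -> 1 - \sum_i (1 - x i) <= \prod_i x i.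
Proof.
move=> x01.
suff : (1 - \sum_i (1 - x i) <= \prod_i x i) && (0 <= \prod_i x i <= 1) by case/andP.
elim/big_rec2 : _ => [|i y z _ /andP[yz /andP[y0 y1]]]; first by rewrite subr0 lexx ler01.
have /andP[xi0 xi1] := x01 i.
apply/andP; split; last by rewrite mulr_ge0 //= mulr_ile1.
have : 0 <= (1 - x i) * (1 - z) by rewrite mulr_ge0 ?subr_ge0.
lra.
Qed.

(** The index types T_ i depend on i, hence dependent finite products rather
than finite functions. *)
Lemma sum_prod_fprod (I : finType) (T_ : I -> finType) (f : forall i, T_ i -> R) :
  \sum_(t : fprod T_) \prod_i f i (t i) = \prod_i \sum_t f i t.
Proof.
pose g i := [ffun t => f i t].
transitivity (\sum_(t : fprod T_) \prod_i g i (t i)).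
  by apply: eq_bigr => t _; apply: eq_bigr => i _; rewrite ffunE.
rewrite (@big_fprod _ _ _ _ _ _ _ g).
rewrite -(@bigA_distr_big_dep _ _ _ _ _ _ _ (fun i u => u \in tagged_with T_ i)
  (fun i => untag 0 (g i))); apply: eq_bigr => i _.
by rewrite -(big_tag g); apply: eq_bigr => t _; rewrite ffunE.
Qed.
End Affinity.

Section Assouad.
Variables (R : realType) (J : finType).

Definition flip (th : {ffun J -> bool}) (j : J) : {ffun J -> bool} :=
  [ffun k => if k == j then ~~ th k else th k].

Lemma flipK j : involutive (flip^~ j).
Proof. by move=> th; apply/ffunP => k; rewrite !ffunE; case: eqP; rewrite ?negbK. Qed.

Lemma flip_sign th j : (-1) ^+ flip th j j = - (-1) ^+ th j :> R.
Proof. by rewrite ffunE eqxx signrN. Qed.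

Lemma sum_flip j (F : {ffun J -> bool} -> R) : \sum_th F th = \sum_th F (flip th j).
Proof. by rewrite (reindex_inj (inv_inj (flipK j))). Qed.

(** Averaging over the whole hypercube pairs each vertex th with flip th j, so
that each coordinate becomes a test between two laws, to which two_point_bound
applies. The laws may have total mass below 1, which is what truncation of an
infinite outcome space produces. *)
Lemma assouad (W : finType) (D : {pred J}) (p : {ffun J -> bool} -> W -> R)
    (x : W -> J -> R) (h : R) :
  (forall th w, 0 <= p th w) ->
  (forall th, \sum_w p th w <= 1) ->
  (forall th, \sum_(j in D) (1 - \sum_w Num.sqrt (p th w * p (flip th j) w))
     <= #|D|%:R / 4) ->
  exists th, h ^+ 2 * #|D|%:R / 2 <=
    \sum_w p th w * \sum_(j in D) (x w j - h * (-1) ^+ th j) ^+ 2.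
Proof.
move=> p0 p1 aff.
have pair j th : h ^+ 2 * (4 * \sum_w Num.sqrt (p th w * p (flip th j) w) - 2) <=
    \sum_w p th w * (x w j - h * (-1) ^+ th j) ^+ 2 +
    \sum_w p (flip th j) w * (x w j - h * (-1) ^+ flip th j j) ^+ 2.
  rewrite -big_split /=.
  apply: le_trans (_ : \sum_w h ^+ 2 * (4 * Num.sqrt (p th w * p (flip th j) w)
      - (p th w + p (flip th j) w)) <= _).
    rewrite -mulr_sumr ler_wpM2l ?sqr_ge0 // sumrB -mulr_sumr big_split /=.
    by have := p1 th; have := p1 (flip th j); lra.
  apply: ler_sum => w _; rewrite flip_sign.
  have := two_point_bound (x w j) (h * (-1) ^+ th j) (p0 th w) (p0 (flip th j) w).
  by rewrite exprMn sqrr_sign mulr1 mulrN opprK.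
have avg : \sum_(th : {ffun J -> bool}) h ^+ 2 * #|D|%:R / 2 <= 
    \sum_th \sum_w p th w * \sum_(j in D) (x w j - h * (-1) ^+ th j) ^+ 2.
  under [leRHS]eq_bigr do under eq_bigr do rewrite mulr_sumr.
  under [leRHS]eq_bigr do rewrite exchange_big /=.
  rewrite exchange_big /=.
  rewrite (_ : \sum_(j in D) _ = \sum_(j in D) \sum_th
     (\sum_w p th w * (x w j - h * (-1) ^+ th j) ^+ 2 +
    \sum_w p (flip th j) w * (x w j - h * (-1) ^+ flip th j j) ^+ 2) / 2); last first.
    apply: eq_bigr => j _; rewrite -mulr_suml big_split /=.
    rewrite -(sum_flip j (fun th =>
      \sum_w p th w * (x w j - h * (-1) ^+ th j) ^+ 2)).
    by field.
  rewrite exchange_big /=; apply: ler_sum => th _.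
  apply: le_trans (ler_sum _ (fun j _ => ler_wpM2r _ (pair j th))) => //.
  rewrite -mulr_suml ler_wpM2r // -mulr_sumr ler_wpM2l ?sqr_ge0 //.
  have := aff th; rewrite !sumrB -mulr_sumr !sumr_const -[2 *+ _]mulr_natr; lra.
apply/existsP; apply: contraLR avg => /existsPn nle.
rewrite -ltNge; apply: ltr_sum => [|th _]; last by rewrite ltNge nle.
by apply/hasP; exists [ffun=> true]; rewrite ?mem_index_enum.
Qed.

(** The affinity of two product laws is the product of the affinities, hence at
least 1 minus the sum of the defects; the defect of a factor is at most the lost
mass e plus half the information carried by that factor. *)
Lemma assouad_product (I : finType) (T_ : I -> finType) (D : {pred J})
    (q : {ffun J -> bool} -> forall i, T_ i -> R)
    (x : fprod T_ -> J -> R) (h e V : R) :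
  (forall th i t, 0 <= q th i t) ->
  (forall th i, 1 - e <= \sum_t q th i t <= 1) ->
  (forall th i, \sum_(j in D) \sum_t
     (q th i t - q (flip th j) i t) ^+ 2 / (q th i t + q (flip th j) i t) <= V) ->
  #|I|%:R * (#|D|%:R * e + V / 2) <= #|D|%:R / 4 ->
  exists th, h ^+ 2 * #|D|%:R / 2 <=
    \sum_(w : fprod T_) (\prod_i q th i (w i)) *
      \sum_(j in D) (x w j - h * (-1) ^+ th j) ^+ 2.
Proof.
move=> q0 q1 qV small.
apply: (@assouad _ D (fun th (w : fprod T_) => \prod_i q th i (w i))) => [th w|th|th].
- exact: prodr_ge0.
- rewrite sum_prod_fprod; apply: prodr_ile1 => i _.
  by rewrite sumr_ge0 //=; case/andP: (q1 th i).
- apply: le_trans small.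
  have aff j : 1 - \sum_(w : fprod T_)
      Num.sqrt (\prod_i q th i (w i) * \prod_i q (flip th j) i (w i)) <=
    \sum_i (e + (\sum_t
     (q th i t - q (flip th j) i t) ^+ 2 / (q th i t + q (flip th j) i t)) / 2).
    under eq_bigr => w _.
      rewrite -big_split /= sqrtr_prod; last by move=> i; rewrite mulr_ge0.
      over.
    rewrite (sum_prod_fprod (fun i t => Num.sqrt (q th i t * q (flip th j) i t))).
    set g := fun i : I => \sum_t Num.sqrt (q th i t * q (flip th j) i t).
    have gle i : g i <= (\sum_t q th i t + \sum_t q (flip th j) i t) / 2.
      rewrite -big_split /= mulr_suml; apply: ler_sum => t _.
      have := two_point_bound 0 1 (q0 th i t) (q0 (flip th j) i t); lra.
    have gge i : (\sum_t q th i t + \sum_t q (flip th j) i t) / 2 - (\sum_t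
     (q th i t - q (flip th j) i t) ^+ 2 / (q th i t + q (flip th j) i t)) / 2 <= g i.
      rewrite -big_split /= !mulr_suml -sumrB; apply: ler_sum => t _.
      exact: sqrtM_ge.
    apply: (@le_trans _ _ (\sum_i (1 - g i))).
      rewrite lerBlDr -lerBlDl; apply: prod_ge_subsum => i.
      rewrite sumr_ge0 => [/=|t _]; last exact: sqrtr_ge0.
      by have := gle i; have := q1 th i; have := q1 (flip th j) i; lra.
    apply: ler_sum => i _.
    by have := gge i; have := q1 th i; have := q1 (flip th j) i; lra.
  apply: le_trans (ler_sum _ (fun j _ => aff j)) _.
  rewrite exchange_big /= -[#|I|]sum1_card natr_sum mulr_suml.
  apply: ler_sum => i _; rewrite mul1r big_split /= sumr_const.
  rewrite -[e *+ _]mulr_natl -mulr_suml.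
  by have := qV th i; lra.
Qed.
End Assouad.

(** * Quadratic forms on a hypercube of frames *)

Section QuadraticForm.
Variables (R : realType) (d : nat).
Implicit Types (v : 'I_d -> R) (a b k : 'I_d).

Lemma sum_delta (F : 'I_d -> R) a : \sum_i (i == a)%:R * F i = F a.
Proof.
rewrite (bigD1 a) //= eqxx mul1r big1 ?addr0 // => i /negPf ->.
by rewrite mul0r.
Qed.

Lemma card_ltn_ord m : (m <= d)%N -> #|[pred b : 'I_d | (b < m)%N]| = m.
Proof.
move=> md; rewrite -sum1_card -[RHS]card_ord -sum1_card.
by rewrite (big_ord_widen d (fun _ => 1%N) md).
Qed.

Lemma card_geq_ord m : (m <= d)%N -> #|[pred a : 'I_d | (m <= a)%N]| = (d - m)%N.
Proof.
move=> md; have := cardC [pred b : 'I_d | (b < m)%N].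
rewrite card_ltn_ord // card_ord => h.
apply/eqP; rewrite -(eqn_add2l m) subnKC // -[X in _ == X]h eqn_add2l.
by apply/eqP/eq_card => a; rewrite !inE -leqNgt.
Qed.

(** The positions, in the lower left block, of the entries that carry the signs
parametrising the hypercube. *)
Definition coord_block m : {pred 'I_d * 'I_d} :=
  [pred j : 'I_d * 'I_d | (m <= j.1)%N && (j.2 < m)%N].

Lemma sum_coord_block m (F : 'I_d * 'I_d -> R) :
  \sum_(j in coord_block m) F j =
  \sum_(b : 'I_d | (b < m)%N) \sum_(a : 'I_d | (m <= a)%N) F (a, b).
Proof.
rewrite exchange_big /= pair_big /=.
by apply: eq_big => [[a b]|[a b] _].
Qed.

Lemma card_coord_block m : (m <= d)%N -> #|coord_block m| = (m * (d - m))%N.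
Proof.
move=> md; apply/eqP; rewrite -(eqr_nat R) -sumr_const sum_coord_block.
rewrite sumr_const sumr_const -[X in X *+ #|_|]mulr_natl card_ltn_ord // card_geq_ord //.
by rewrite mulr1 -mulrnA mulnC.
Qed.

Variable S : 'I_d -> 'I_d -> R.
Hypothesis Ssym : forall a b, S a b = S b a.

Definition quad v : R := \sum_a \sum_b v a * S a b * v b.

(** Only the two terms linear in the displacement and its square survive; when
v a = s, replacing S by S - mu for any scalar mu leaves the right-hand side
unchanged, which frame_prob_flip exploits. *)
Lemma quad_shift v a s :
  quad v - quad (fun k => v k - 2 * s * (k == a)%:R) =
  4 * s * (\sum_b S a b * v b - s * S a a).
Proof.
rewrite /quad -sumrB.
transitivity (\sum_i \sum_j
   ((2 * s) * ((i == a)%:R * (S i j * v j) + (j == a)%:R * (S j i * v i))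
    - (2 * s) ^+ 2 * ((i == a)%:R * ((j == a)%:R * S i j)))).
  apply: eq_bigr => i _; rewrite -sumrB; apply: eq_bigr => j _.
  by rewrite (Ssym j i); ring.
under eq_bigr do rewrite sumrB -!mulr_sumr big_split /= -mulr_sumr !sum_delta.
rewrite sumrB -!mulr_sumr sum_delta big_split /=.
rewrite (sum_delta (fun i => \sum_j S i j * v j)).
by ring.
Qed.

End QuadraticForm.

Section Family.
Variables (R : realType) (d r m : nat) (de : R).
Hypotheses (mr : (m <= r)%N) (rd : (r <= d)%N).
Local Notation theta := {ffun 'I_d * 'I_d -> bool}.
Implicit Types (th : theta) (a b k : 'I_d).

(** The tilts of the vectors k < m point into the span of the basis vectors
a >= m, which are themselves not tilted: the vectors stay linearly independent
for all signs, which keeps the rank fixed, and their lengths do not change. *)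
Definition frame th k a : R :=
  (a == k)%:R + (if (m <= a)%N && (k < m)%N then de * (-1) ^+ th (a, k) else 0).

(** The trace of the state before its normalisation, by frame_mass_sum. *)
Definition frame_mass : R := r%:R + de ^+ 2 * (m * (d - m))%:R.

Lemma frame_sqr th k : \sum_a frame th k a ^+ 2 =
  1 + (if (k < m)%N then de ^+ 2 * (d - m)%:R else 0).
Proof.
have md := leq_trans mr rd.
transitivity (\sum_a ((a == k)%:R * 1 +
    if (m <= a)%N then (if (k < m)%N then de ^+ 2 else 0) else 0)).
  apply: eq_bigr => a _; rewrite /frame mulr1.
  have [->|ak] := eqVneq a k.
    by rewrite leqNgt; case: (k < m)%N; rewrite /= !addr0 expr1n.
  rewrite !add0r; case: (m <= a)%N => //=; last by rewrite expr0n.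
  by case: ifP; rewrite ?expr0n // exprMn sqrr_sign mulr1.
rewrite big_split /= (sum_delta (fun=> 1)) -big_mkcond sumr_const; congr (_ + _).
rewrite (card_geq_ord md); case: ifP => _; first by rewrite mulr_natr.
by rewrite mul0rn.
Qed.

Lemma frame_mass_sum th :
  \sum_(k : 'I_d | (k < r)%N) \sum_a frame th k a ^+ 2 = frame_mass.
Proof.
have md := leq_trans mr rd.
under eq_bigr do rewrite frame_sqr.
rewrite big_split /= sumr_const card_ltn_ord //; congr (_ + _).
rewrite -big_mkcondr /= (eq_bigl (fun k : 'I_d => (k < m)%N)); last first.
  by move=> k /=; rewrite andb_idl // => /leq_trans; apply.
by rewrite sumr_const card_ltn_ord // natrM -[LHS]mulr_natr; ring.
Qed.

Lemma frame_flip th a b : (m <= a)%N -> (b < m)%N ->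
  frame (flip th (a, b)) b =1
  fun k => frame th b k - 2 * (de * (-1) ^+ th (a, b)) * (k == a)%:R.
Proof.
move=> ma bm k; rewrite /frame bm andbT ffunE xpair_eqE eqxx andbT.
have [->|ka] := eqVneq k a; last by rewrite mulr0 subr0.
by rewrite ma mulr1 signrN; ring.
Qed.

Lemma frame_flip_neq th a b k : k != b -> frame (flip th (a, b)) k =1 frame th k.
Proof. by move=> kb l; rewrite /frame ffunE xpair_eqE (negbTE kb) andbF. Qed.

Variable (S : 'I_d -> 'I_d -> R) (mu beta : R).
Hypothesis Ssym : forall a b, S a b = S b a.
Hypothesis mu0 : 0 <= mu.
Hypothesis quad_ge : forall v, mu * \sum_a v a ^+ 2 <= quad S v.
Hypothesis dev_le : forall v,
  \sum_a (\sum_b S a b * v b - mu * v a) ^+ 2 <= (beta * mu) ^+ 2 * \sum_a v a ^+ 2.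

Definition frame_prob th : R :=
  frame_mass^-1 * \sum_(k : 'I_d | (k < r)%N) quad S (frame th k).

Hypothesis r0 : (0 < r)%N.
Hypothesis de_small : de ^+ 2 * d%:R <= 1.

Lemma frame_mass_ge : r%:R <= frame_mass.
Proof. by rewrite lerDl mulr_ge0 ?sqr_ge0. Qed.

Lemma frame_mass_gt0 : 0 < frame_mass.
Proof. by apply: lt_le_trans frame_mass_ge; rewrite ltr0n. Qed.

Lemma frame_prob_ge th : mu <= frame_prob th.
Proof.
rewrite ler_pdivlMl ?frame_mass_gt0 // mulrC -(frame_mass_sum th) mulr_sumr.
by apply: ler_sum => k _; apply: quad_ge.
Qed.

(** Since the flipped coordinate of the frame vector equals the displacement, the
scalar part mu of S cancels: a multiple of the identity carries no information
about the signs. *)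
Lemma frame_prob_flip th a b : (m <= a)%N -> (b < m)%N ->
  frame_prob th - frame_prob (flip th (a, b)) =
  frame_mass^-1 * (4 * (de * (-1) ^+ th (a, b)) *
    ((\sum_k S a k * frame th b k - mu * frame th b a)
     - de * (-1) ^+ th (a, b) * (S a a - mu))).
Proof.
move=> ma bm; rewrite /frame_prob -mulrBr; congr (_ * _).
have br : (b < r)%N by apply: leq_trans mr.
rewrite (bigD1 b) //= [X in _ - X](bigD1 b) //=.
rewrite (eq_bigr (fun k => quad S (frame (flip th (a, b)) k))); last first.
  move=> k /andP[_ kb]; apply: eq_bigr => i _; apply: eq_bigr => j _.
  by rewrite !frame_flip_neq.
rewrite opprD addrACA subrr addr0 (_ : quad S (frame (flip _ _) b) =
   quad S (fun k => frame th b k - 2 * (de * (-1) ^+ th (a, b)) * (k == a)%:R));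
  last first.
  by apply: eq_bigr => i _; apply: eq_bigr => j _; rewrite !frame_flip.
rewrite quad_shift //; have -> : frame th b a = de * (-1) ^+ th (a, b).
  rewrite /frame ma bm /=; case: eqVneq => [ab|_]; last by rewrite add0r.
  by rewrite ab leqNgt bm in ma.
by ring.
Qed.

(** For a fixed b the sum over a of the squared entries of (S - mu) v is a single
squared length, not d times the square of the operator norm. This saving of a
factor d is the source of the rate. *)
Lemma frame_info th : \sum_(j in @coord_block d m)
   (frame_prob th - frame_prob (flip th j)) ^+ 2 /
   (frame_prob th + frame_prob (flip th j))
   <= 48 * de ^+ 2 * m%:R * beta ^+ 2 * mu / frame_mass ^+ 2.
Proof.
have md := leq_trans mr rd.
set N := frame_mass; have N0 : 0 < N := frame_mass_gt0.
pose G (v : 'I_d -> R) a := \sum_b S a b * v b - mu * v a.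
pose B := (beta * mu) ^+ 2.
have dem : de ^+ 2 * (d - m)%:R <= 1.
  by apply: le_trans de_small; rewrite ler_wpM2l ?sqr_ge0 // ler_nat leq_subr.
(* The diagonal correction is bounded through the columns of S - mu. *)
have Gaa a : (S a a - mu) ^+ 2 <= B.
  have one : \sum_(k < d) ((k == a)%:R : R) ^+ 2 = 1.
    rewrite -[RHS](sum_delta (fun=> 1) a); apply: eq_bigr => k _.
    by rewrite mulr1; case: (k == a); rewrite /= ?expr1n ?expr0n.
  have := dev_le (fun k => (k == a)%:R); rewrite /= one.
  rewrite mulr1; apply: le_trans.
  rewrite (bigD1 a) //= eqxx mulr1 (_ : \sum_b _ = S a a); last first.
    by rewrite -[RHS](sum_delta (S a)); apply: eq_bigr => k _; rewrite mulrC.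
  by rewrite lerDl sumr_ge0 // => k _; rewrite sqr_ge0.
have sq a b : (m <= a)%N -> (b < m)%N ->
   (frame_prob th - frame_prob (flip th (a, b))) ^+ 2 <=
   32 * de ^+ 2 / N ^+ 2 * (G (frame th b) a ^+ 2 + de ^+ 2 * B).
  move=> ma bm; rewrite frame_prob_flip // -/N -/(G _ _).
  set g := G _ a; set s := (-1) ^+ _; set h := _ - mu.
  have s2 : s ^+ 2 = 1 by apply: sqrr_sign.
  have -> : (N^-1 * (4 * (de * s) * (g - de * s * h))) ^+ 2 =
     16 * de ^+ 2 / N ^+ 2 * (s ^+ 2 * (g - de * s * h) ^+ 2).
    by field; rewrite gt_eqF.
  rewrite s2 mul1r.
  have -> : 32 * de ^+ 2 / N ^+ 2 * (g ^+ 2 + de ^+ 2 * B) =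
     16 * de ^+ 2 / N ^+ 2 * (2 * g ^+ 2 + 2 * (de ^+ 2 * B)).
    by field; rewrite gt_eqF.
  apply: ler_wpM2l; first by rewrite divr_ge0 ?sqr_ge0 // mulr_ge0 ?sqr_ge0.
  have h1 : de ^+ 2 * h ^+ 2 <= de ^+ 2 * B by rewrite ler_wpM2l ?sqr_ge0 ?Gaa.
  have h2 : (de * s * h) ^+ 2 = de ^+ 2 * h ^+ 2 by rewrite !exprMn s2 mulr1.
  have h3 : 0 <= (g + de * s * h) ^+ 2 by rewrite sqr_ge0.
  rewrite -h2 in h1; move: h1 h3; set u := de * s * h => h1 h3.
  have h4 : (g - u) ^+ 2 + (g + u) ^+ 2 = 2 * g ^+ 2 + 2 * u ^+ 2 by ring.
  lra.
rewrite sum_coord_block.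
(* If mu = 0 the denominators may vanish, but then so do all numerators. *)
have [mu_z|mu_gt] := leP mu 0.
  have {}mu_z : mu = 0 by apply/eqP; rewrite eq_le mu_z mu0.
  have G0 b a : G (frame th b) a ^+ 2 = 0.
    apply/eqP; rewrite eq_le sqr_ge0 andbT.
    have := dev_le (frame th b); rewrite mu_z mulr0 expr0n mul0r => h.
    apply: le_trans h; rewrite (bigD1 a) //= /G mu_z lerDl sumr_ge0 // => k _.
    exact: sqr_ge0.
  rewrite big1 => [|b bm]; first by rewrite mu_z mulr0 mul0r.
  rewrite big1 // => a ma; have := sq a b ma bm.
  rewrite G0 /B mu_z mulr0 expr0n !mulr0 addr0 mulr0 => h.
  by rewrite (_ : _ ^+ 2 = 0) ?mul0r //; apply/eqP; rewrite eq_le h sqr_ge0.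
have B0 : 0 <= B by apply: sqr_ge0.
apply: (@le_trans _ _ (\sum_(b : 'I_d | (b < m)%N)
    48 * de ^+ 2 * beta ^+ 2 * mu / N ^+ 2)); last first.
  rewrite sumr_const card_ltn_ord // -[X in X <= _]mulr_natr le_eqVlt; apply/orP; left.
  by apply/eqP; ring.
apply: ler_sum => b bm.
apply: (@le_trans _ _ (\sum_(a : 'I_d | (m <= a)%N)
   32 * de ^+ 2 / N ^+ 2 * (G (frame th b) a ^+ 2 + de ^+ 2 * B) / (2 * mu))).
  apply: ler_sum => a ma.
  have p2 : 2 * mu <= frame_prob th + frame_prob (flip th (a, b)).
    by rewrite mulr_natl mulr2n lerD // frame_prob_ge.
  have p20 : 0 < 2 * mu by rewrite mulr_gt0.
  apply: ler_pM; rewrite ?sqr_ge0 ?invr_ge0 //; first by apply: le_trans p2; apply: ltW.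
    exact: sq.
  by rewrite lef_pV2 ?posrE // (lt_le_trans p20).
rewrite -mulr_suml -mulr_sumr big_split /= sumr_const card_geq_ord //.
have G2 : \sum_(a : 'I_d | (m <= a)%N) G (frame th b) a ^+ 2 <= 2 * B.
  apply: (@le_trans _ _ (\sum_a G (frame th b) a ^+ 2)).
    rewrite [leRHS](bigID (fun a : 'I_d => (m <= a)%N)) /= lerDl.
    by rewrite sumr_ge0 // => k _; rewrite sqr_ge0.
  apply: le_trans (dev_le _) _; rewrite mulrC ler_wpM2r // frame_sqr bm.
  lra.
have D2 : (de ^+ 2 * B) *+ (d - m) <= B.
  by rewrite -mulr_natr mulrAC ler_piMl.
rewrite (_ : 48 * _ * _ * _ / _ = 32 * de ^+ 2 / N ^+ 2 * (3 * B) / (2 * mu)); last first.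
  by rewrite /B; field; rewrite !gt_eqF.
rewrite ler_wpM2r ?invr_ge0 ?mulr_ge0 // ler_wpM2l ?(sqr_ge0, divr_ge0, mulr_ge0) //.
apply: le_trans (lerD G2 D2) _; lra.
Qed.

End Family.

(** * Adjoints, Gram matrices and the trace norm *)

Local Open Scope complex_scope.
Local Open Scope sesquilinear_scope.

Section Adjoint.
Variable R : realType.
Implicit Types (m n p d : nat).
Local Notation C := R[i].

Lemma ReD (x y : C) : complex.Re (x + y) = complex.Re x + complex.Re y.
Proof. by case: x y => [a b] [c e]. Qed.

Lemma ReN (x : C) : complex.Re (- x) = - complex.Re x.
Proof. by case: x => [a b]. Qed.

Lemma ReB (x y : C) : complex.Re (x - y) = complex.Re x - complex.Re y.
Proof. by rewrite ReD ReN. Qed.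

Lemma Re_sum (I : Type) (s : seq I) (P : pred I) (F : I -> C) :
  complex.Re (\sum_(i <- s | P i) F i) = \sum_(i <- s | P i) complex.Re (F i).
Proof. by apply: (big_morph _ ReD). Qed.

Lemma ReZ (a : R) (x : C) : complex.Re (a%:C * x) = a * complex.Re x.
Proof. by case: x => [b c] /=; rewrite mul0r subr0. Qed.

Definition sqmod (z : C) : R := complex.Re z ^+ 2 + complex.Im z ^+ 2.

Lemma sqmod_ge0 z : 0 <= sqmod z. Proof. by rewrite addr_ge0 ?sqr_ge0. Qed.

Lemma sqmodE z : z * Num.conj z = (sqmod z)%:C.
Proof.
case: z => a b; rewrite /sqmod /= /real_complex_def /Num.conj /=.
by congr Complex; rewrite /=; ring.
Qed.

Lemma adjointM m n p (A : 'M[C]_(m, n)) (B : 'M[C]_(n, p)) :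
  (A *m B) ^t* = B ^t* *m A ^t*.
Proof. by rewrite trmx_mul map_mxM. Qed.

Lemma adjointD m n (A B : 'M[C]_(m, n)) : (A + B) ^t* = A ^t* + B ^t*.
Proof. by rewrite linearD /= map_mxD. Qed.

Lemma adjointZ m n (a : R) (A : 'M[C]_(m, n)) : (a%:C *: A) ^t* = a%:C *: A ^t*.
Proof.
apply/matrixP => i j; rewrite !mxE rmorphM /=; congr (_ * _).
by rewrite /Num.conj /= oppr0.
Qed.

Lemma adjointE m n (A : 'M[C]_(m, n)) i j : (A ^t*) i j = Num.conj (A j i).
Proof. by rewrite !mxE. Qed.

Lemma mxtr11 (A : 'M[C]_1) : \tr A = A 0 0.
Proof. by rewrite /mxtrace big_ord1. Qed.

Lemma gram_diag m n (A : 'M[C]_(m, n)) i :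
  (A *m A ^t*) i i = (\sum_k sqmod (A i k))%:C.
Proof. by rewrite mxE rmorph_sum; apply: eq_bigr => k _; rewrite adjointE sqmodE. Qed.

Lemma gram_diagr m n (A : 'M[C]_(m, n)) i :
  (A ^t* *m A) i i = (\sum_k sqmod (A k i))%:C.
Proof.
by rewrite mxE rmorph_sum; apply: eq_bigr => k _; rewrite adjointE mulrC sqmodE.
Qed.

Lemma psdmx_gram d m (A : 'M[C]_(d, m)) : psdmx (A *m A ^t*).
Proof.
split; first by apply/is_hermitianmxP; rewrite expr0 scale1r adjointM trmxCK.
move=> v; rewrite mulmxA -mulmxA -{2}(trmxCK v) -adjointM gram_diag ler0c.
by rewrite sumr_ge0 // => k _; rewrite sqmod_ge0.
Qed.

Lemma psdmxD d (A B : 'M[C]_d) : psdmx A -> psdmx B -> psdmx (A + B).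
Proof.
move=> [/is_hermitianmxP hA pA] [/is_hermitianmxP hB pB]; split.
  apply/is_hermitianmxP; rewrite adjointD scalerDr -hA -hB //.
by move=> v; rewrite mulmxDr mulmxDl mxE addr_ge0.
Qed.

Lemma psdmxZ d (a : R) (A : 'M[C]_d) : 0 <= a -> psdmx A -> psdmx (a%:C *: A).
Proof.
move=> a0 [/is_hermitianmxP hA pA]; split.
  apply/is_hermitianmxP; rewrite adjointZ scalerA [_ * a%:C]mulrC -scalerA -hA //.
by move=> v; rewrite -scalemxAr -scalemxAl mxE mulr_ge0 // ler0c.
Qed.

(** Cauchy-Schwarz for the real part, by 2 x y <= s x^2 + y^2 / s with the
optimal s, the norm of v. *)
Lemma Re_sum_mul_le (I : finType) (u v : I -> C) :
  \sum_i sqmod (u i) = 1 ->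
  complex.Re (\sum_i u i * v i) <= Num.sqrt (\sum_i sqmod (v i)).
Proof.
move=> u1; set D := \sum_i sqmod (v i).
have D0 : 0 <= D by rewrite sumr_ge0 // => i _; rewrite sqmod_ge0.
have [Dp|Dz] := ltP 0 D; last first.
  have {}Dz : D = 0 by apply/eqP; rewrite eq_le Dz D0.
  rewrite Dz sqrtr0 Re_sum big1 // => i _.
  have /eqP := Dz; rewrite psumr_eq0 => [/allP/(_ i)|j _]; last exact: sqmod_ge0.
  rewrite mem_index_enum => /(_ isT); rewrite /sqmod paddr_eq0 ?sqr_ge0 // !sqrf_eq0.
  by case: (v i) (u i) => a b [a' b'] /= /andP[/eqP-> /eqP->]; rewrite !mulr0 subr0.
set s := Num.sqrt D; have s0 : 0 < s by rewrite sqrtr_gt0.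
have sD : D = s ^+ 2 by rewrite sqr_sqrtr.
apply: (@le_trans _ _ (\sum_i (s / 2 * sqmod (u i) + s^-1 / 2 * sqmod (v i))));
  last first.
  rewrite big_split /= -!mulr_sumr u1 -/D sD le_eqVlt; apply/orP; left; apply/eqP.
  by field; rewrite gt_eqF.
rewrite Re_sum; apply: ler_sum => i _; rewrite /sqmod.
case: (u i) (v i) => a b [a' b'] /=.
rewrite -subr_ge0.
rewrite [leRHS](_ : _ = ((s * a - a') ^+ 2 + (s * b + b') ^+ 2) / (2 * s)); last first.
  by field; rewrite gt_eqF.
by rewrite divr_ge0 ?addr_ge0 ?sqr_ge0 // mulr_ge0 ?ltW.
Qed.

Lemma sqrtC_real (x : R) : 0 <= x -> sqrtC (x%:C : C) = (Num.sqrt x)%:C.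
Proof.
move=> x0; rewrite -{1}(sqr_sqrtr x0) rmorphXn /= sqrCK //.
by rewrite ler0c sqrtr_ge0.
Qed.

Lemma gram_spectralE d (A : 'M[C]_d) (G := A ^t* *m A) (P := spectralmx G) :
  G = P ^t* *m diag_mx (spectral_diag G) *m P.
Proof.
rewrite -(invmx_unitary (spectral_unitarymx _)).
apply/orthomx_spectralP/hermitian_normalmx/is_hermitianmxP.
by rewrite expr0 scale1r /G adjointM trmxCK.
Qed.

(** Because <p, A^* A p> = |A p|^2 for the unit eigenvectors p, the columns of
P^*. *)
Lemma spectral_diag_gram d (A : 'M[C]_d) (G := A ^t* *m A) i :
  spectral_diag G 0 i = (\sum_k sqmod ((A *m (spectralmx G) ^t*) k i))%:C.
Proof.
set P := spectralmx G; have PP : P *m P ^t* = 1%:M by apply/unitarymxP/spectral_unitarymx.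
have GE : G = P ^t* *m diag_mx (spectral_diag G) *m P := gram_spectralE A.
rewrite -gram_diagr adjointM trmxCK mulmxA -[P *m _ *m _]mulmxA -/G.
rewrite [X in P *m X *m _]GE !mulmxA PP mul1mx -mulmxA PP.
by rewrite mulmx1 mxE eqxx.
Qed.

(** Duality between the trace norm and the operator norm. The trace of Z A is
computed in an orthonormal eigenbasis of A^* A: the images of its vectors under A
have the singular values of A as lengths, while the rows of Z are unit vectors.
The factor 2 undoes the normalisation of trace_norm. *)
Lemma Re_tr_unitary_le d (Z A : 'M[C]_d) : Z *m Z ^t* = 1%:M ->
  complex.Re (\tr (Z *m A)) <= 2 * trace_norm A.
Proof.
move=> ZZ; rewrite /trace_norm mulrCA mulfV ?mulr1 // /absmx /sqrtmx.
set G := A ^t* *m A; set P := spectralmx G.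
have Pu : P \is unitarymx by apply: spectral_unitarymx.
rewrite [in leRHS]mxtrace_mulC [in leRHS]mulmxA mulmxV ?unitarymx_unit //.
rewrite mul1mx mxtrace_diag.
have -> : \tr (Z *m A) = \tr ((P *m Z) *m (A *m P ^t*)).
  rewrite [RHS]mxtrace_mulC mulmxA -[_ *m _ *m P]mulmxA -(invmx_unitary Pu).
  by rewrite mulVmx ?unitarymx_unit // mulmx1 mxtrace_mulC.
rewrite !Re_sum; apply: ler_sum => i _.
rewrite mxE mxE spectral_diag_gram sqrtC_real ?sumr_ge0 // => [/=|k _];
  last exact: sqmod_ge0.
apply: Re_sum_mul_le; apply: complexI.
rewrite -gram_diag adjointM mulmxA -[P *m Z *m _]mulmxA ZZ.
by rewrite mulmx1 (unitarymxP Pu) mxE eqxx.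
Qed.
End Adjoint.

(** * Gentle effects are nearly scalar *)

Section Gentle.
Variables (R : realType) (d : nat).
Local Notation C := R[i].
Implicit Types (x y : 'cV[C]_d) (A : 'M[C]_d).

Definition qform A x : R := complex.Re ((x ^t* *m A *m x) 0 0).

Lemma qform_tr A x : qform A x = complex.Re (\tr (x *m x ^t* *m A)).
Proof. by rewrite -mulmxA mxtrace_mulC mxtr11. Qed.

Lemma qformB A B x : qform (A - B) x = qform A x - qform B x.
Proof. by rewrite /qform mulmxBr mulmxBl !mxE ReB. Qed.

Lemma qformZ (a : R) A x : qform (a%:C *: A) x = a * qform A x.
Proof. by rewrite /qform -scalemxAr -scalemxAl mxE ReZ. Qed.

Lemma qformD A B x : qform (A + B) x = qform A x + qform B x.
Proof. by rewrite /qform mulmxDr mulmxDl mxE ReD. Qed.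

Lemma qform_gram m (B : 'M[C]_(d, m)) x :
  qform (B *m B ^t*) x = \sum_k sqmod ((x ^t* *m B) 0 k).
Proof. by rewrite /qform mulmxA -mulmxA -{2}(trmxCK x) -adjointM gram_diag. Qed.

(** The reflection Z = 1 - 2 x x^* is unitary and Re tr (Z A) = - 2 <x, A x> when
A is traceless, so that the factor 2 of Re_tr_unitary_le disappears; using Z and
- Z gives both signs. *)
Lemma qform_le_trace_norm A x : x ^t* *m x = 1%:M ->
  complex.Re (\tr A) = 0 -> `|qform A x| <= trace_norm A.
Proof.
move=> x1 trA.
have ZZ : (1%:M - 2%:R *: (x *m x ^t*)) *m (1%:M - 2%:R *: (x *m x ^t*)) ^t* = 1%:M.
  have -> : (1%:M - 2%:R *: (x *m x ^t*)) ^t* = 1%:M - 2%:R *: (x *m x ^t*).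
    rewrite linearB /= map_mxB trmx1 map_mx1; congr (_ - _).
    have -> : (2%:R : C) = (2%:R)%:C by rewrite rmorph_nat.
    by rewrite adjointZ adjointM trmxCK.
  rewrite mulmxBl mul1mx mulmxBr mulmx1 -scalemxAl -scalemxAr scalerA.
  rewrite mulmxA -[x *m _ *m x]mulmxA x1 mulmx1 opprB.
  set X := x *m x ^t*.
  by rewrite -natrM !scaler_nat -addrA [- _ + _]addrC -addrA -opprD -mulrnDr subrr addr0.
have tr1 : complex.Re (\tr ((1%:M - 2%:R *: (x *m x ^t*)) *m A)) = - (2 * qform A x).
  rewrite mulmxBl mul1mx -scalemxAl linearB linearZ /= ReB trA sub0r qform_tr.
  have -> : (2%:R : C) = (2%:R)%:C by rewrite rmorph_nat.
  by rewrite /= ReZ.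
have ZZ' : (- (1%:M - 2%:R *: (x *m x ^t*))) *m
    (- (1%:M - 2%:R *: (x *m x ^t*))) ^t* = 1%:M.
  by rewrite -[RHS]ZZ linearN /= map_mxN mulmxN mulNmx opprK.
have := Re_tr_unitary_le A ZZ; have := Re_tr_unitary_le A ZZ'.
rewrite mulNmx linearN ReN /= tr1 ler_norml; lra.
Qed.

Lemma qform_gram_ge0 m (B : 'M[C]_(d, m)) x : 0 <= qform (B *m B ^t*) x.
Proof. by rewrite qform_gram sumr_ge0 // => k _; rewrite sqmod_ge0. Qed.

(** The real inequality behind gentle_two_point: l^2 and m^2 are the probabilities
of the outcome for x and y, q is the weight of x in the mixture. For m > 0 the
weight q = m / (l + m) gives the mixture the probability l m. *)
Lemma affine_overlap_le (l m alpha S : R) : 0 <= alpha < 1 / 2 ->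
  0 < l -> 0 <= m -> (1 - alpha) * l ^+ 2 <= S ->
  (forall q, 0 <= q <= 1 -> 0 < q * l ^+ 2 + (1 - q) * m ^+ 2 ->
    q * S <= (q + alpha) * (q * l ^+ 2 + (1 - q) * m ^+ 2)) ->
  l - m <= 2 * alpha * (l + m).
Proof.
move=> alphaP lp m0 S1 ovl.
have [mz|mp] := leP m 0.
  have {}mz : m = 0 by apply/eqP; rewrite eq_le mz m0.
  (* If y never yields the outcome, any positive weight q is moved to 1. *)
  exfalso; have q01 : 0 <= (1 - 2 * alpha) / 2 <= 1 by lra.
  have := ovl _ q01; rewrite mz expr0n mulr0 addr0.
  set q := (_ / 2); have q0 : 0 < q by rewrite /q; lra.
  rewrite mulr_gt0 ?exprn_gt0 // => /(_ isT).
  rewrite mulrCA ler_pM2l // => /(le_trans S1); rewrite ler_pM2r ?exprn_gt0 // /q; lra.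
have lm : 0 < l + m by rewrite addr_gt0.
have q01 : 0 <= m / (l + m) <= 1.
  apply/andP; split; first by rewrite divr_ge0 // ltW.
  by rewrite ler_pdivrMr // mul1r lerDr ltW.
have := ovl _ q01.
have -> : m / (l + m) * l ^+ 2 + (1 - m / (l + m)) * m ^+ 2 = l * m.
  by field; rewrite gt_eqF.
rewrite mulr_gt0 // => /(_ isT) h.
have : m / (l + m) * ((1 - alpha) * l ^+ 2) <= (m / (l + m) + alpha) * (l * m).
  by apply: le_trans h; rewrite ler_wpM2l //; case/andP: q01.
have -> : m / (l + m) * ((1 - alpha) * l ^+ 2) = ((1 - alpha) * l / (l + m)) * (l * m).
  by field; rewrite gt_eqF.
rewrite ler_pM2r ?mulr_gt0 // ler_pdivrMr // [leRHS]mulrDl divfK ?gt_eqF // => h2.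
have : 0 <= alpha * m by rewrite mulr_ge0 //; case/andP: alphaP.
lra.
Qed.


Lemma mulmx_comb k1 k2 k3 k4 (a b : C) (A : 'M[C]_(k1, k2)) (X Y : 'M[C]_(k2, k3))
    (B : 'M[C]_(k3, k4)) :
  A *m (a *: X + b *: Y) *m B = a *: (A *m X *m B) + b *: (A *m Y *m B).
Proof. by rewrite mulmxDr mulmxDl -!scalemxAr -!scalemxAl. Qed.

Variables (alpha : R) (M : op_family R d) (w : outcome M).
Hypothesis gM : gentle alpha M.

Lemma qform_effect_ge0 x : 0 <= qform (effect w) x.
Proof. by rewrite /effect -{2}(trmxCK (op w)) qform_gram_ge0. Qed.

(** Gentleness is only ever used through overlaps with a unit vector. *)
Lemma gentle_overlap rho x : density_mx rho -> 0 < outcome_prob rho w ->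
  x ^t* *m x = 1%:M ->
  `|qform rho x - (outcome_prob rho w)^-1 * qform (op w *m rho *m (op w) ^t*) x|
    <= alpha.
Proof.
move=> drho p0 x1; apply: le_trans (gM drho p0).
rewrite -qformZ -qformB; apply: qform_le_trace_norm => //.
case: drho => _ tr1; rewrite linearB /= linearZ /= ReB ReZ tr1.
rewrite mxtrace_mulC mulmxA mxtrace_mulC -/(effect w) -/(outcome_prob rho w).
by rewrite mulVf ?gt_eqF // subrr.
Qed.

(** The mixture of x and y is measured; its post-measurement state is the mixture
of those of x and y with weights proportional to q l^2 and (1 - q) m^2, and the
overlap with x is kept by the first part up to alpha and nonnegative on the
second. *)
Lemma gentle_two_point x y : 0 <= alpha < 1 / 2 ->
  x ^t* *m x = 1%:M -> y ^t* *m y = 1%:M -> x ^t* *m y = 0 ->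
  Num.sqrt (qform (effect w) x) - Num.sqrt (qform (effect w) y) <=
  2 * alpha * (Num.sqrt (qform (effect w) x) + Num.sqrt (qform (effect w) y)).
Proof.
move=> alphaP x1 y1 xy.
set l := Num.sqrt (qform _ x); set m := Num.sqrt (qform _ y).
have l0 : 0 <= l by rewrite sqrtr_ge0.
have m0 : 0 <= m by rewrite sqrtr_ge0.
have lE : qform (effect w) x = l ^+ 2 by rewrite sqr_sqrtr ?qform_effect_ge0.
have mE : qform (effect w) y = m ^+ 2 by rewrite sqr_sqrtr ?qform_effect_ge0.
have a0 : 0 <= alpha by case/andP: alphaP.
have [lz|lp] := leP l 0.
  have : 0 <= alpha * (l + m) by rewrite mulr_ge0 ?addr_ge0.
  lra.
pose rho q : 'M[C]_d := q%:C *: (x *m x ^t*) + (1 - q)%:C *: (y *m y ^t*).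
have drho q : 0 <= q <= 1 -> density_mx (rho q).
  move=> /andP[q0 q1]; split.
    by apply: psdmxD; apply: psdmxZ; rewrite ?subr_ge0 //; apply: psdmx_gram.
  rewrite /rho mxtraceD !mxtraceZ ![\tr (_ *m _ ^t*)]mxtrace_mulC x1 y1 !mxtr11 !mxE /=.
  by rewrite !mulr1 -rmorphD addrC subrK.
have prho q : outcome_prob (rho q) w = q * l ^+ 2 + (1 - q) * m ^+ 2.
  rewrite /outcome_prob /rho -[_ *m effect w]mul1mx mulmxA mulmx_comb !mul1mx.
  by rewrite mxtraceD !mxtraceZ ReD !ReZ -!qform_tr lE mE.
pose S := qform (op w *m (x *m x ^t*) *m (op w) ^t*) x.
have ovl q : 0 <= q <= 1 -> 0 < outcome_prob (rho q) w ->
    q * S <= (q + alpha) * outcome_prob (rho q) w.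
  move=> q01 p0; have := gentle_overlap (drho q q01) p0 x1.
  rewrite ler_norml => /andP[+ _].
  have -> : qform (rho q) x = q.
    rewrite qformD !qformZ !qform_gram !big_ord1 x1 xy !mxE /sqmod /=.
    by rewrite !expr0n /= !addr0 expr1n mulr0 mulr1 addr0.
  have : q * S <= qform (op w *m rho q *m (op w) ^t*) x.
    rewrite /rho mulmx_comb qformD !qformZ -/S lerDl.
    rewrite mulr_ge0 ?subr_ge0 //; first by case/andP: q01.
    rewrite (_ : _ *m _ = (op w *m y) *m (op w *m y) ^t*) ?qform_gram_ge0 //.
    by rewrite adjointM !mulmxA.
  move: p0; move: (qform (_ *m rho q *m _) x) (outcome_prob _ _) => X P p0 h1.
  rewrite lerBrDr addrC lerBlDr ler_pdivrMl // mulrC.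
  exact: le_trans.
have S1 : (1 - alpha) * l ^+ 2 <= S.
  have p1 : outcome_prob (rho 1) w = l ^+ 2 by rewrite prho subrr mul0r mul1r addr0.
  have p0 : 0 < outcome_prob (rho 1) w by rewrite p1 exprn_gt0.
  have := gentle_overlap (drho 1 _) p0 x1; rewrite ler01 lexx => /(_ isT).
  rewrite ler_norml => /andP[_]; rewrite p1 {1 2}/rho subrr !scale0r !addr0 !scale1r -/S.
  rewrite qform_gram big_ord1 x1 mxE /sqmod /= expr0n expr1n addr0.
  by rewrite lerBlDr -lerBlDl ler_pdivlMl ?exprn_gt0 // mulrC.
by apply: (affine_overlap_le alphaP lp m0 S1) => q q01; rewrite -prho; apply: ovl.
Qed.

End Gentle.

Section EffectSpectrum.
Variables (R : realType) (d : nat).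
Local Notation C := R[i].

Lemma sqmod_unitary (U : 'M[C]_d) (x : 'cV[C]_d) : U ^t* *m U = 1%:M ->
  \sum_k sqmod ((U *m x) k 0) = \sum_k sqmod (x k 0).
Proof.
move=> U1; apply: (@complexI R).
rewrite -!gram_diagr adjointM mulmxA -[_ *m _ *m U]mulmxA.
by rewrite U1 mulmx1.
Qed.

Lemma sqmodZ (a : R) (z : C) : sqmod (a%:C * z) = a ^+ 2 * sqmod z.
Proof. by rewrite /sqmod; case: z => b c /=; ring. Qed.

Lemma qform_diag (s : 'I_d -> R) (y : 'cV[C]_d) :
  qform (diag_mx (\row_i (s i)%:C)) y = \sum_i s i * sqmod (y i 0).
Proof.
rewrite /qform mul_mx_diag mxE Re_sum; apply: eq_bigr => i _.
rewrite !mxE mulrAC [_ * y i 0]mulrC sqmodE -rmorphM /=; exact: mulrC.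
Qed.

Lemma qform_effect (M : op_family R d) (w : outcome M) (x : 'cV[C]_d) :
  qform (effect w) x = \sum_k sqmod ((op w *m x) k 0).
Proof.
by rewrite /qform /effect mulmxA -adjointM -mulmxA gram_diagr.
Qed.

(** The hypothesis l - m <= 2 alpha (l + m) first yields l <= m / c0, because
1 - 2 alpha >= 2 c0, and then bounds (l - m) (l + m). *)
Lemma sqr_ratio_le (l m alpha c0 : R) : 0 < c0 -> 0 <= alpha <= 1 / 2 - c0 ->
  0 <= m -> m <= l -> l - m <= 2 * alpha * (l + m) ->
  l ^+ 2 - m ^+ 2 <= 2 * (1 + 1 / c0) ^+ 2 * alpha * m ^+ 2.
Proof.
move=> c00 /andP[a0 ac] m0 ml h.
have l0 : 0 <= l by apply: le_trans ml.
have lc : l <= m / c0.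
  rewrite ler_pdivlMr //.
  have h1 : 0 <= l * (1 / 2 - c0 - alpha) by rewrite mulr_ge0 ?subr_ge0.
  have h2 : 0 <= m * (1 / 2 - alpha) by rewrite mulr_ge0 //; lra.
  lra.
apply: (@le_trans _ _ (2 * alpha * (l + m) ^+ 2)).
  rewrite (_ : _ - _ = (l - m) * (l + m)); last by ring.
  by rewrite expr2 [leRHS]mulrA ler_wpM2r ?addr_ge0.
rewrite (_ : 2 * _ * _ * _ = 2 * alpha * (m / c0 + m) ^+ 2); last first.
  by field; rewrite gt_eqF.
rewrite ler_wpM2l ?mulr_ge0 //.
by rewrite ler_sqr ?nnegrE ?lerD2r // !addr_ge0 // divr_ge0 // ltW.
Qed.

(** All eigenvectors of the effect are compared with one for the least eigenvalue
mu; hence all the eigenvalues lie between mu and mu (1 + O(alpha)). *)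
Lemma gentle_effect (alpha c0 : R) (M : op_family R d) (w : outcome M) : (0 < d)%N ->
  0 < c0 -> 0 <= alpha <= 1 / 2 - c0 -> gentle alpha M ->
  exists2 mu, 0 <= mu & forall x : 'cV[C]_d,
    mu * \sum_k sqmod (x k 0) <= qform (effect w) x /\
    \sum_k sqmod (((effect w - mu%:C%:M) *m x) k 0) <=
      (2 * (1 + 1 / c0) ^+ 2 * alpha * mu) ^+ 2 * \sum_k sqmod (x k 0).
Proof.
move=> d0 c00 /andP[a0 ac] gM.
have a12 : 0 <= alpha < 1 / 2 by rewrite a0 /=; lra.
set kappa := 2 * _; have k0 : 0 <= kappa by rewrite mulr_ge0 ?sqr_ge0.
set P := spectralmx (effect w).
pose s i := \sum_k sqmod ((op w *m P ^t*) k i).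
have s0 i : 0 <= s i by apply: sumr_ge0 => k _; apply: sqmod_ge0.
have EE : effect w = P ^t* *m diag_mx (\row_i (s i)%:C) *m P.
  have -> : \row_i (s i)%:C = spectral_diag (effect w).
    by apply/rowP => i; rewrite mxE; apply/esym/spectral_diag_gram.
  exact: gram_spectralE.
have Pu : P \is unitarymx by apply: spectral_unitarymx.
have PP := unitarymxP Pu.
have PP' : P ^t* *m P = 1%:M by rewrite -(invmx_unitary Pu) mulVmx ?unitarymx_unit.
pose i0 : 'I_d := Ordinal d0.
have [i1 _ imin] := @Order.TotalTheory.arg_minP _ _ _ i0 xpredT s isT.
pose mu := s i1; exists mu; first exact: s0.
have smu j : 0 <= s j - mu <= kappa * alpha * mu.
  rewrite subr_ge0 imin //=.
  have [->|ji] := eqVneq j i1.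
    rewrite subrr; apply: mulr_ge0; last exact: s0.
    exact: mulr_ge0.
  have ortho i j' : (col i (P ^t*)) ^t* *m col j' (P ^t*) = (i == j')%:R%:M.
    apply/matrixP => u v; rewrite !ord1.
    have := congr1 (fun N : 'M[C]_d => N i j') PP; rewrite !mxE eqxx mulr1n => <-.
    by apply: eq_bigr => k _; rewrite !mxE conjCK.
  have qE i : qform (effect w) (col i (P ^t*)) = s i.
    by rewrite qform_effect; apply: eq_bigr => k _; rewrite colE mulmxA -colE mxE.
  have /= := gentle_two_point w gM a12 (etrans (ortho j j) _)
    (etrans (ortho i1 i1) _) (etrans (ortho j i1) _).
  rewrite !eqxx (negbTE ji) raddf0 => /(_ erefl erefl erefl).
  rewrite !qE => h; have := sqr_ratio_le c00 _ _ _ h.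
  rewrite a0 ac sqrtr_ge0 ler_sqrt // imin // !sqr_sqrtr //.
  by apply.
pose D : 'M[C]_d := diag_mx (\row_i (s i)%:C).
move=> x; split.
  rewrite EE (_ : qform _ x = qform D (P *m x)); last first.
    by rewrite /qform adjointM !mulmxA.
  rewrite -(sqmod_unitary x PP') qform_diag mulr_sumr; apply: ler_sum => k _.
  by rewrite ler_wpM2r ?sqmod_ge0 // imin.
have -> : (effect w - mu%:C%:M) *m x = P ^t* *m ((D - mu%:C%:M) *m (P *m x)).
  rewrite mulmxBl [in RHS]mulmxBl mulmxBr !mul_scalar_mx -scalemxAr !mulmxA PP' mul1mx.
  by rewrite -/D -EE.
rewrite sqmod_unitary ?trmxCK // -(sqmod_unitary x PP') mulr_sumr; apply: ler_sum => k _.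
have -> : ((D - mu%:C%:M) *m (P *m x)) k 0 = (s k - mu)%:C * (P *m x) k 0.
  by rewrite mulmxBl mul_scalar_mx mul_diag_mx !mxE rmorphB mulrBl.
rewrite sqmodZ ler_wpM2r ?sqmod_ge0 //; have /andP[h1 h2] := smu k.
by rewrite ler_sqr ?nnegrE // (le_trans h1).
Qed.

End EffectSpectrum.

(** * Probabilities of finitely many outcomes and tensor products *)

Section Outcomes.
Import numFieldNormedType.Exports.
Variables (R : realType) (d : nat).
Local Notation C := R[i].

(** The comparison with 0 is in the complex numbers: it also says that the trace
is real, so that taking real parts in outcome_prob loses nothing. *)
Lemma psdmx_tr_gram_ge0 (rho : 'M[C]_d) m (B : 'M[C]_(m, d)) : psdmx rho ->
  0 <= \tr (rho *m (B ^t* *m B)).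
Proof.
move=> [_ rho0].
rewrite mulmxA mxtrace_mulC mulmxA; apply: sumr_ge0 => k _.
have := rho0 ((row k B) ^t*).
rewrite trmxCK; congr (_ <= _); rewrite !mxE.
apply: eq_bigr => l _; rewrite !mxE; congr (_ * _).
by apply: eq_bigr => u _; rewrite !mxE.
Qed.

Variable M : op_family R d.

Lemma outcome_probE (rho : 'M[C]_d) (w : outcome M) : psdmx rho ->
  (outcome_prob rho w)%:C = \tr (rho *m effect w).
Proof.
move=> prho; rewrite /outcome_prob RRe_real //.
by rewrite realE psdmx_tr_gram_ge0.
Qed.

Lemma outcome_prob_ge0 (rho : 'M[C]_d) (w : outcome M) : psdmx rho ->
  0 <= outcome_prob rho w.
Proof. by move=> prho; rewrite -ler0c outcome_probE // psdmx_tr_gram_ge0. Qed.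

(** The convergence of the effects is entrywise; the trace against rho is
controlled by the sum s of the moduli of the entries of rho (plus 1, to be
positive). *)
Lemma measurement_prob_cvg (rho : 'M[C]_d) e : is_measurement M ->
  \tr rho = 1 -> 0 < e ->
  exists F0 : {fset outcome M}, forall F, (F0 `<=` F)%fset ->
    `|\sum_(w : F) outcome_prob rho (val w) - 1| < e.
Proof.
move=> Mm tr1 e0.
pose s := 1 + \sum_i \sum_j Normc.normc (rho i j).
have n0 (z : C) : 0 <= Normc.normc z by case: z => a b; rewrite sqrtr_ge0.
have s0 : 0 < s by rewrite ltr_pwDl // !sumr_ge0 // => i _; rewrite sumr_ge0.
have es0 : 0 < (e / s)%:C by rewrite ltcR divr_gt0.
have [F0 _ HF] := Mm _ (nbhsx_ballx (1%:M : 'M[C^o]_d) _ es0).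
exists F0 => F sF.
have {}HF := HF F sF.
have entry i j : Normc.normc ((\sum_(w : F) effect (val w) - 1%:M) i j) < e / s.
  have : ball ((1%:M : 'M[C^o]_d) i j) (e / s)%:C
    ((summability.partial_sum (fun w : outcome M => effect w : 'M[C^o]_d) F) i j).
    by case: HF => _; apply.
  rewrite -ball_normE /= distrC.
  have -> : summability.partial_sum (fun w : outcome M => effect w : 'M[C^o]_d) F i j -
     (1%:M : 'M[C^o]_d) i j = (\sum_(w : F) effect (val w) - 1%:M) i j.
    by rewrite [RHS]mxE [in RHS]mxE.
  by rewrite -ltcR.
have -> : \sum_(w : F) outcome_prob rho (val w) - 1 =
   \sum_i \sum_j complex.Re (rho i j * (\sum_(w : F) effect (val w) - 1%:M) j i).
  rewrite /outcome_prob -Re_sum -linear_sum -mulmx_sumr /=.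
  have -> : 1 = complex.Re (\tr (rho *m 1%:M)) by rewrite mulmx1 tr1.
  rewrite -ReB -raddfB /= -mulmxBr /mxtrace Re_sum; apply: eq_bigr => i _.
  by rewrite mxE Re_sum.
have Rez (z : C) : `|complex.Re z| <= Normc.normc z.
  case: z => a b /=; rewrite -sqrtr_sqr ler_sqrt ?addr_ge0 ?sqr_ge0 //.
  by rewrite lerDl sqr_ge0.
apply: le_lt_trans (ler_norm_sum _ _ _) _.
apply: (@le_lt_trans _ _ ((s - 1) * (e / s))).
  have -> : s - 1 = \sum_i \sum_j Normc.normc (rho i j) by rewrite /s addrC addKr.
  rewrite mulr_suml; apply: ler_sum => i _.
  apply: le_trans (ler_norm_sum _ _ _) _; rewrite mulr_suml; apply: ler_sum => j _.
  apply: le_trans (Rez _) _; rewrite Normc.normcM ler_wpM2l //.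
  exact/ltW/entry.
rewrite mulrBl mulrCA mulfV ?gt_eqF // mulr1 mul1r ltrBlDr ltrDl.
by rewrite divr_gt0.
Qed.

Lemma measurement_prob_le1 (rho : 'M[C]_d) (F : {fset outcome M}) : is_measurement M ->
  density_mx rho -> \sum_(w : F) outcome_prob rho (val w) <= 1.
Proof.
move=> Mm [prho tr1]; apply/ler_addgt0Pr => e e0.
have [F0 /(_ (F0 `|` F)%fset (fsubsetUl _ _))] := measurement_prob_cvg Mm tr1 e0.
rewrite ltr_norml => /andP[_]; rewrite ltrBlDr addrC => /ltW; apply: le_trans.
rewrite -!(big_seq_fsetE _ _ predT (fun w => outcome_prob rho w)).
rewrite (big_fsetID _ (mem F) (F0 `|` F)%fset) /=.
rewrite (_ : [fset x in (F0 `|` F) | x \in F]%fset = F); last first.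
  by apply/fsetP => x; rewrite !inE /= andb_orl andbb orb_idl // => /andP[].
by rewrite lerDl sumr_ge0 // => w _; apply: outcome_prob_ge0.
Qed.

(** A single finite set of outcomes serves finitely many states, since the
required lower bound persists when the set grows. *)
Lemma measurement_truncation (I : finType) (rho : I -> 'M[C]_d) e : is_measurement M ->
  (forall i, density_mx (rho i)) -> 0 < e ->
  exists F : {fset outcome M}, forall i,
    1 - e <= \sum_(w : F) outcome_prob (rho i) (val w) <= 1.
Proof.
move=> Mm drho e0.
have /boolp.choice[F HF] : forall i, exists F0 : {fset outcome M},
    forall F, (F0 `<=` F)%fset ->
    `|\sum_(w : F) outcome_prob (rho i) (val w) - 1| < e.
  by move=> i; apply: measurement_prob_cvg => //; case: (drho i).
exists (\bigcup_(i <- enum I) F i)%fset => i; rewrite measurement_prob_le1 // andbT.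
have /(HF i) : (F i `<=` \bigcup_(i <- enum I) F i)%fset.
  by apply: bigfcup_sup; rewrite ?mem_enum.
by rewrite ltr_norml => /andP[/ltW + _]; rewrite lerBrDr addrC.
Qed.

End Outcomes.

Section Tensor.
Variables (R : realType) (n d : nat).
Local Notation C := R[i].

(** Expanding the product of the sums that define the entries of the A i *m B i
gives the sum over all multi-indices. *)
Lemma tensor_mxM (A B : 'I_n -> 'M[C]_d) :
  tensor_mx A *m tensor_mx B = tensor_mx (fun i => A i *m B i).
Proof.
apply/matrixP => a b; rewrite !mxE.
under [RHS]eq_bigr do rewrite mxE.
rewrite bigA_distr_bigA /=.
rewrite (reindex (fun f : {ffun 'I_n -> 'I_d} => enum_rank f)) /=; last first.
  exact/onW_bij/enum_rank_bij.
by apply: eq_bigr => f _; rewrite !mxE enum_rankK -big_split.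
Qed.

Lemma tensor_mx_adj (A : 'I_n -> 'M[C]_d) :
  (tensor_mx A) ^t* = tensor_mx (fun i => (A i) ^t*).
Proof.
by apply/matrixP => a b; rewrite !mxE rmorph_prod; apply: eq_bigr => i _; rewrite !mxE.
Qed.

Lemma tr_tensor_mx (A : 'I_n -> 'M[C]_d) : \tr (tensor_mx A) = \prod_i \tr (A i).
Proof.
rewrite /mxtrace bigA_distr_bigA /=.
rewrite (reindex (fun f : {ffun 'I_n -> 'I_d} => enum_rank f)) /=; last first.
  exact/onW_bij/enum_rank_bij.
by apply: eq_bigr => f _; rewrite !mxE enum_rankK.
Qed.

Lemma outcome_prob_tensor (M : 'I_n -> op_family R d) (rho : 'M[C]_d)
    (w : outcome (tensor_family M)) : psdmx rho ->
  outcome_prob (tensor_mx (fun _ : 'I_n => rho)) w =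
  \prod_i outcome_prob rho ((w : {dffun forall i : 'I_n, outcome (M i)}) i).
Proof.
move=> prho; rewrite /outcome_prob /effect /= tensor_mx_adj !tensor_mxM tr_tensor_mx.
transitivity (complex.Re (\prod_i
    (outcome_prob rho ((w : {dffun forall i : 'I_n, outcome (M i)}) i))%:C)).
  by congr complex.Re; apply: eq_bigr => i _; rewrite outcome_probE.
by rewrite -rmorph_prod.
Qed.
End Tensor.

(** * The hypercube of states of rank r *)

Section RealEffect.
Variables (R : realType) (d : nat).
Local Notation C := R[i].

Lemma ReM_real (a : R) (z : C) : complex.Re (z * a%:C) = complex.Re z * a.
Proof. by rewrite mulrC ReZ mulrC. Qed.

Lemma conj_real (a : R) : Num.conj (a%:C : C) = a%:C.
Proof. by rewrite /Num.conj /= oppr0. Qed.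

Lemma sqmod_real (a : R) : sqmod (a%:C : C) = a ^+ 2.
Proof. by rewrite /sqmod /= expr0n addr0. Qed.

Definition re_effect (M : op_family R d) (w : outcome M) (a b : 'I_d) : R :=
  complex.Re (effect w a b).

Lemma re_effect_sym (M : op_family R d) (w : outcome M) a b :
  re_effect w a b = re_effect w b a.
Proof.
rewrite /re_effect /effect !mxE !Re_sum; apply: eq_bigr => k _; rewrite !mxE.
case: (op w k a) (op w k b) => x y [x' y'].
by rewrite /Num.conj /= !mulNr mulrC [y * _]mulrC.
Qed.

Lemma qform_real (M : op_family R d) (w : outcome M) (v : 'I_d -> R) :
  qform (effect w) (\col_k (v k)%:C) = quad (re_effect w) v.
Proof.
rewrite /qform /quad -mulmxA mxE Re_sum; apply: eq_bigr => a _.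
rewrite adjointE mxE conj_real mxE ReZ Re_sum mulr_sumr; apply: eq_bigr => b _.
by rewrite [(\col_k _) b 0]mxE ReM_real mulrA.
Qed.

Lemma gentle_re_effect (alpha c0 : R) (M : op_family R d) (w : outcome M) : (0 < d)%N ->
  0 < c0 -> 0 <= alpha <= 1 / 2 - c0 -> gentle alpha M ->
  exists mu, [/\ 0 <= mu,
    forall v : 'I_d -> R, mu * \sum_a v a ^+ 2 <= quad (re_effect w) v
  & forall v : 'I_d -> R,
    \sum_a (\sum_b re_effect w a b * v b - mu * v a) ^+ 2 <=
    (2 * (1 + 1 / c0) ^+ 2 * alpha * mu) ^+ 2 * \sum_a v a ^+ 2].
Proof.
move=> d0 c00 a0 gM; have [mu mu0 H] := gentle_effect w d0 c00 a0 gM.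
have norm v : \sum_k sqmod ((\col_k (v k)%:C : 'cV[C]_d) k 0) = \sum_a v a ^+ 2.
  by apply: eq_bigr => k _; rewrite mxE sqmod_real.
exists mu; split=> // v; have [h1 h2] := H (\col_k (v k)%:C).
  by rewrite -norm -qform_real.
rewrite -(norm v); apply: le_trans h2; apply: ler_sum => a _.
rewrite (_ : _ - _ = complex.Re (((effect w - mu%:C%:M) *m \col_k (v k)%:C) a 0)).
  by rewrite /sqmod lerDl sqr_ge0.
rewrite mulmxBl mul_scalar_mx [in RHS]mxE ReD; congr (_ + _).
  rewrite mxE Re_sum; apply: eq_bigr => b _.
  by rewrite [(\col_k _) b 0]mxE ReM_real.
by rewrite [in RHS]mxE ReN !mxE ReZ.
Qed.
End RealEffect.

Section FrameState.
Variables (R : realType) (d r m : nat) (de : R).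
Hypotheses (mr : (m <= r)%N) (rd : (r <= d)%N) (r0 : (0 < r)%N).
Local Notation C := R[i].
Local Notation theta := {ffun 'I_d * 'I_d -> bool}.
Implicit Types (th : theta).

Definition frame_mx th : 'M[C]_d := \matrix_(a, k) (frame m de th k a)%:C.

Definition frame_state th : 'M[C]_d :=
  ((frame_mass d r m de)^-1)%:C *:
    ((frame_mx th *m (pid_mx r : 'M[C]_d)) *m (frame_mx th *m (pid_mx r : 'M[C]_d)) ^t*).

Lemma frame_pidE th a k :
  (frame_mx th *m (pid_mx r : 'M[C]_d)) a k =
  (if (k < r)%N then frame m de th k a else 0)%:C.
Proof.
rewrite mxE (bigD1 k) //= !mxE eqxx big1 ?addr0 => [|l lk].
  by case: ifP => _; rewrite /= ?mulr1 // mulr0.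
by rewrite !mxE -val_eqE in lk *; rewrite (negbTE lk) mulr0.
Qed.

(** The tilts form a strictly lower block, hence a matrix X with X^2 = 0, and
1 + X has inverse 1 - X. *)
Lemma frame_mx_unit th : frame_mx th \in unitmx.
Proof.
pose X := frame_mx th - 1%:M.
have XE a k : X a k =
    (if (m <= a)%N && (k < m)%N then (de * (-1) ^+ th (a, k))%:C else 0).
  rewrite !mxE /frame rmorphD /= rmorph_nat addrC addrA addNr add0r.
  by case: ifP.
have XX : X *m X = 0.
  apply/matrixP => a k; rewrite !mxE big1 // => l _; rewrite !XE.
  case: (ltnP l m) => lm; first by rewrite /= mulr0.
  by rewrite andbF mul0r.
have WE : frame_mx th = 1%:M + X by rewrite addrC subrK.
have : frame_mx th *m (1%:M - X) = 1%:M.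
  by rewrite WE mulmxDl mul1mx mulmxBr mulmx1 XX subr0 subrK.
by case/mulmx1_unit.
Qed.

(** The state is W pid W^* up to a positive factor, where W is invertible and pid
is the projector onto the first r coordinates. *)
Lemma frame_state_rank th : density_mx_rank r (frame_state th).
Proof.
have N0 := frame_mass_gt0 d m de r0.
split; last first.
  rewrite mxrank_scale_nz; last first.
    by rewrite -(rmorph0 (real_complex R)) (inj_eq (@complexI R)) invr_eq0 gt_eqF.
  have pid_adj : (pid_mx r : 'M[C]_d) ^t* = pid_mx r by rewrite tr_pid_mx map_pid_mx.
  rewrite adjointM pid_adj -mulmxA [pid_mx r *m (_ *m _)]mulmxA pid_mx_id //.
  have Wf := frame_mx_unit th.
  rewrite mulmxA mxrankMfree; last first.
    by rewrite row_free_unit map_unitmx unitmx_tr.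
  rewrite (eqmxMfull _ (_ : row_full (frame_mx th))) ?row_full_unit //.
  by rewrite rank_pid_mx.
split.
  by apply: psdmxZ; [rewrite invr_ge0 ltW | apply: psdmx_gram].
rewrite mxtraceZ /mxtrace.
under eq_bigr do rewrite gram_diag.
rewrite -rmorph_sum -rmorphM /= exchange_big /=.
rewrite (_ : \sum_j _ = frame_mass d r m de) ?mulVf ?gt_eqF //.
rewrite -(frame_mass_sum de mr rd th) [RHS]big_mkcond /=; apply: eq_bigr => k _.
under eq_bigr do rewrite frame_pidE sqmod_real.
case: ifP => // _; by rewrite big1 // => i _; rewrite expr0n.
Qed.

Lemma outcome_prob_frame th (M : op_family R d) (w : outcome M) :
  outcome_prob (frame_state th) w = frame_prob r m de (re_effect w) th.
Proof.
rewrite /outcome_prob /frame_state -scalemxAl mxtraceZ ReZ /frame_prob; congr (_ * _).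
rewrite -mulmxA mxtrace_mulC /mxtrace Re_sum [RHS]big_mkcond /=.
apply: eq_bigr => k _; rewrite mxE Re_sum.
case: ifP => kr; last first.
  by rewrite big1 // => b _; rewrite frame_pidE kr mulr0.
rewrite /quad exchange_big /=; apply: eq_bigr => b _.
rewrite frame_pidE kr ReM_real -mulr_suml mxE Re_sum; congr (_ * _).
by apply: eq_bigr => a _; rewrite !adjointE frame_pidE kr conj_real ReZ.
Qed.

(** The frame vectors other than the b-th one vanish in coordinate b, so that a
single sign contributes to the entry. *)
Lemma Re_frame_state th j : j \in @coord_block d m ->
  complex.Re (frame_state th j.1 j.2) = de / frame_mass d r m de * (-1) ^+ th j.
Proof.
case: j => a b; rewrite inE /= => /andP[ma bm].
rewrite mxE ReZ mxE Re_sum (bigD1 b) //= adjointE !frame_pidE (leq_trans bm mr).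
rewrite conj_real -rmorphM /= big1 ?addr0 => [|k kb].
  have ab : a == b = false by apply/eqP => ab; rewrite ab leqNgt bm in ma.
  rewrite /frame ma bm ab eqxx [(m <= b)%N]leqNgt bm /= add0r addr0 mulr1.
  by rewrite mulrC mulrAC.
rewrite adjointE !frame_pidE conj_real -rmorphM /=.
case: ifP => _; rewrite ?mulr0 // /frame [b == k]eq_sym (negbTE kb).
by rewrite [(m <= b)%N]leqNgt bm /= addr0 mulr0.
Qed.

Lemma frobenius_ge (A : 'M[C]_d) th :
  \sum_(j in @coord_block d m) (complex.Re (A j.1 j.2) -
     de / frame_mass d r m de * (-1) ^+ th j) ^+ 2 <=
  frobenius_norm (A - frame_state th) ^+ 2.
Proof.
rewrite sqr_sqrtr; last by do 2 (apply: sumr_ge0 => ? _); apply: sqr_ge0.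
rewrite pair_big /= [leRHS](bigID [in @coord_block d m]) /=.
apply: ler_wpDr; first by apply: sumr_ge0 => j _; rewrite sqr_ge0.
apply: ler_sum => j jD; rewrite -(Re_frame_state th jD) -ReB.
have -> : A j.1 j.2 - frame_state th j.1 j.2 = (A - frame_state th) j.1 j.2.
  by rewrite !mxE.
case: (_ j.1 j.2) => x y /=; rewrite sqr_sqrtr ?addr_ge0 ?sqr_ge0 //.
by rewrite lerDl sqr_ge0.
Qed.

End FrameState.

(** * The minimax bound *)

Section Risk.
Variables (R : realType) (n d : nat) (M : 'I_n -> op_family R d).
Local Notation C := R[i].
Variable F : forall i : 'I_n, {fset outcome (M i)}.

Definition joint_outcome (w : fprod (fun i => F i : finType)) :
    outcome (tensor_family M) :=
  [ffun i => val (w i)] : {dffun forall i : 'I_n, outcome (M i)}.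

Lemma joint_outcome_inj : injective joint_outcome.
Proof.
move=> u w /ffunP uw; apply/fprodP => i; apply/val_inj.
by have := uw i; rewrite !ffunE.
Qed.

(** The risk is a supremum of finite partial sums, and the outcomes in a product
of finite sets form one of them. *)
Lemma risk_ge (est : outcome (tensor_family M) -> 'M[C]_d) (rho : 'M[C]_d) : psdmx rho ->
  ((\sum_(w : fprod (fun i => F i : finType)) (\prod_i outcome_prob rho (val (w i))) *
    frobenius_norm (est (joint_outcome w) - rho) ^+ 2)%:E <= risk est rho)%E.
Proof.
move=> prho; apply: esum_ge.
pose s := [seq joint_outcome w | w <- enum (fprod (fun i => F i : finType))].
have us : uniq s by rewrite map_inj_uniq; [exact: enum_uniq | exact: joint_outcome_inj].
exists [set` s]%classic; first by split=> //; apply: finite_seq.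
rewrite -(fsbig_seq _ _ us) big_map big_enum /= sumEFin lee_fin; apply: ler_sum => w _.
have -> : outcome_prob (tensor_mx (fun=> rho)) (joint_outcome w) =
    \prod_i outcome_prob rho (val (w i)).
  rewrite (outcome_prob_tensor _ prho); apply: eq_bigr => i _; congr outcome_prob.
  by rewrite ffunE.
exact: lexx.
Qed.
End Risk.

Section HardState.
Variables (R : realType) (n d r m : nat) (de alpha c0 : R) (M : 'I_n -> op_family R d).
Local Notation C := R[i].

(** Assouad's lemma for the hypercube of frame states, each effect being nearly
scalar with its own mu; the mu of a finite set of outcomes add up to at most 1,
since mu bounds the probability of the outcome from below. The lost mass
1 / (8 n) per system accounts for half of the budget of assouad_product, and the
numerical hypothesis for the other half. *)
Lemma exists_hard_state (est : outcome (tensor_family M) -> 'M[C]_d) :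
  (0 < n)%N -> (m <= r)%N -> (r <= d)%N -> (0 < r)%N -> de ^+ 2 * d%:R <= 1 ->
  0 < c0 -> 0 <= alpha <= 1 / 2 - c0 -> locally_gentle alpha M ->
  n%:R * (24 * de ^+ 2 * m%:R * (2 * (1 + 1 / c0) ^+ 2 * alpha) ^+ 2 /
      frame_mass d r m de ^+ 2) <=
    (m * (d - m))%:R / 8 ->
  exists2 rho, density_mx_rank r rho &
    (((de / frame_mass d r m de) ^+ 2 * (m * (d - m))%:R / 2)%:E <= risk est rho)%E.
Proof.
move=> n0 mr rd r0 ded c00 a0 gM small.
have d0 : (0 < d)%N by apply: leq_trans rd.
have md := leq_trans mr rd.
have nR : 0 < (n%:R : R) by rewrite ltr0n.
pose st := @frame_state R d r m de.
have stP th : density_mx_rank r (st th) by apply: frame_state_rank.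
have st_psd th : psdmx (st th) by case: (stP th) => -[].
pose e : R := 1 / (8 * n%:R).
have e0 : 0 < e by rewrite divr_gt0 // mulr_gt0.
have trunc : forall i, exists F : {fset outcome (M i)}, forall th,
    1 - e <= \sum_(w : F) outcome_prob (st th) (val w) <= 1.
  move=> i; apply: measurement_truncation => //; first by case: (gM i).
  by move=> th; case: (stP th).
pose F i := sval (cid (trunc i)).
have HF i th : 1 - e <= \sum_(w : F i) outcome_prob (st th) (val w) <= 1.
  exact: (svalP (cid (trunc i)) th).
set beta := 2 * _ * alpha in small.
have info th i : \sum_(j in @coord_block d m) \sum_(t : F i)
   (outcome_prob (st th) (val t) - outcome_prob (st (flip th j)) (val t)) ^+ 2 /
   (outcome_prob (st th) (val t) + outcome_prob (st (flip th j)) (val t))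
   <= 48 * de ^+ 2 * m%:R * beta ^+ 2 / frame_mass d r m de ^+ 2.
  have /boolp.choice[mu Hmu] := fun w : outcome (M i) =>
    gentle_re_effect w d0 c00 a0 (gM i).2.
  rewrite exchange_big /=.
  apply: (@le_trans _ _ (\sum_(t : F i)
      48 * de ^+ 2 * m%:R * beta ^+ 2 / frame_mass d r m de ^+ 2 * mu (val t))).
    apply: ler_sum => t _; have [mu0 h1 h2] := Hmu (val t).
    have eq_term (x y x' y' : R) : x = x' -> y = y' ->
        (x - y) ^+ 2 / (x + y) <= (x' - y') ^+ 2 / (x' + y') by move=> -> ->.
    have pE th' : outcome_prob (st th') (val t) =
        frame_prob r m de (re_effect (val t)) th'.
      exact: outcome_prob_frame.
    rewrite mulrAC.
    apply: le_trans (frame_info mr rd (re_effect_sym _) mu0 h1 h2 r0 ded th).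
    by apply: ler_sum => j _; apply: eq_term (pE _) (pE _).
  rewrite -mulr_sumr ler_piMr //.
    by rewrite divr_ge0 ?sqr_ge0 // mulr_ge0 ?sqr_ge0 // mulr_ge0 // mulr_ge0 ?sqr_ge0.
  have /andP[_] := HF i th; apply: le_trans; apply: ler_sum => t _.
  have [mu0 h1 h2] := Hmu (val t).
  by rewrite outcome_prob_frame // frame_prob_ge.
have := @assouad_product R _ _ (fun i => F i : finType) (@coord_block d m)
  (fun th i t => outcome_prob (st th) (val t))
  (fun w j => complex.Re (est (joint_outcome w) j.1 j.2))
  (de / frame_mass d r m de) e _ (fun th i t => outcome_prob_ge0 _ (st_psd th))
  (fun th i => HF i th) info.
rewrite card_coord_block // card_ord => /(_ _)[|th Hth].
  rewrite (_ : _ * (_ + _) = (m * (d - m))%:R / 8 +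
      n%:R * (24 * de ^+ 2 * m%:R * beta ^+ 2 / frame_mass d r m de ^+ 2)).
    by have := small; set x := n%:R * _; lra.
  have N0 := frame_mass_gt0 d m de r0.
  by rewrite /e; field; rewrite !gt_eqF.
exists (st th) => //; apply: le_trans (risk_ge F est (st_psd th)).
rewrite lee_fin; apply: le_trans Hth _; apply: ler_sum => w _.
rewrite ler_wpM2l ?frobenius_ge //; apply: prodr_ge0 => i _.
exact: outcome_prob_ge0.
Qed.
End HardState.

Section Rate.
Variable R : realType.

Lemma rate_cap_le (d r : nat) : (0 < r <= d)%N -> rate_cap R d r <= 1 / r%:R.
Proof.
move=> /andP[r0 rd]; rewrite /rate_cap; case: eqP => [->|_].
  by rewrite invr1; lra.
have r1 : 1 <= (r%:R : R) by rewrite ler1n.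
have d1 : 1 <= (d%:R : R) by rewrite ler1n (leq_trans r0).
have rdR : (r%:R : R) <= d%:R by rewrite ler_nat.
have bound (x : R) : r%:R <= x -> 1 / (4 * x) <= 1 / r%:R.
  move=> rx; rewrite !div1r lef_pV2 ?posrE ?mulr_gt0 //; lra.
case: ifP => _; last first.
  by apply: bound; rewrite (le_trans rdR) // ler_eXnr.
rewrite -mulrA; apply: bound.
apply: (@le_trans _ _ (r%:R ^+ 5)); first by rewrite ler_eXnr.
by rewrite ler_peMl ?exprn_ge0 ?exprn_ege1 // (le_trans _ r1).
Qed.


(** The number of signs is of order d r: d - m >= d / 2 and m >= r / 3, where
the worst ratio d./2 / d is attained at d = 3. *)
Lemma frame_dim_ge (d r : nat) : (2 <= d)%N -> (r <= d)%N ->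
  (d * r <= 6 * (minn r d./2 * (d - minn r d./2)))%N.
Proof.
move=> d2 rd; set m := minn r d./2.
have h1 : (d <= 2 * (d - m))%N by rewrite /m; lia.
have h2 : (r <= 3 * m)%N by rewrite /m; lia.
by apply: leq_trans (leq_mul h1 h2) _; rewrite mulnACA [(_ * m)%N]mulnC.
Qed.

(** Here D stands for delta^2 and m, N for the number of tilted vectors and the
normalisation of the state. The first term of D keeps N between r and 2 r; the
second one is the largest value allowed by the first inequality: bounding
m / N^2 by 1 / r and m (d - m) from below by d r / 6 leads to
24 * 48 with 48 = 8 * 6. In the second inequality 48 = 2 * 4 * 6 comes from the
1 / 2 of Assouad's lemma, N^2 <= 4 r^2 and the same bound on m (d - m). *)
Lemma frame_rate (n d r : nat) (kappa alpha D : R) (m := minn r d./2)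
    (N := (r%:R + D * (m * (d - m))%:R : R)) :
  (0 < n)%N -> (2 <= d)%N -> (0 < r <= d)%N -> 1 <= kappa -> 0 < alpha ->
  D = Num.min (1 / d%:R) (d%:R * r%:R ^+ 2 / (24 * 48 * kappa ^+ 2 * n%:R * alpha ^+ 2)) ->
  n%:R * (24 * D * m%:R * (kappa * alpha) ^+ 2 / N ^+ 2) <= (m * (d - m))%:R / 8 /\
  1 / (48 * (24 * 48) * kappa ^+ 2) *
    Num.min (rate_cap R d r) (d%:R ^+ 2 * r%:R / (n%:R * alpha ^+ 2)) <=
  D / N ^+ 2 * (m * (d - m))%:R / 2.
Proof.
move=> n0 d2 /andP[r0 rd] k1 a0 DE.
have rR : 0 < (r%:R : R) by rewrite ltr0n.
have dR : 0 < (d%:R : R) by rewrite ltr0n (leq_trans _ d2).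
have nR : 0 < (n%:R : R) by rewrite ltr0n.
have kR : 0 < kappa by apply: lt_le_trans k1.
set E := d%:R * _ / _ in DE.
have k2 : 0 < kappa ^+ 2 by apply: exprn_gt0.
have E0 : 0 < E.
  by rewrite /E; apply: divr_gt0; rewrite !mulr_gt0 // exprn_gt0.
have D0 : 0 < D by rewrite DE lt_min E0 andbT divr_gt0.
have Dd : D * d%:R <= 1 by rewrite -ler_pdivlMr // DE ge_min lexx.
have DE' : D <= E by rewrite DE ge_min lexx orbT.
set K : R := (m * (d - m))%:R.
have K6 : d%:R * r%:R <= 6 * K.
  by rewrite /K -!natrM ler_nat; apply: frame_dim_ge.
have mr : (m%:R : R) <= r%:R by rewrite ler_nat geq_minl.
have KD : D * K <= r%:R.
  apply: le_trans mr; rewrite /K natrM mulrCA ler_piMr //.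
  apply: le_trans Dd; apply: ler_wpM2l; first exact: ltW.
  by rewrite ler_nat leq_subr.
have K0 : 0 <= K by [].
have NrR : r%:R <= N by rewrite lerDl mulr_ge0 // ltW.
have N0 : 0 < N by apply: lt_le_trans NrR.
have N2r : N <= 2 * r%:R by rewrite mulr_natl mulr2n lerD2l.
split.
  apply: (@le_trans _ _ (n%:R * (24 * E * r%:R * (kappa * alpha) ^+ 2 / r%:R ^+ 2))).
    apply: ler_wpM2l; first exact: ltW.
    have D24 : 0 <= 24 * D by rewrite mulr_ge0 // ltW.
    apply: ler_pM.
    - by apply: mulr_ge0; [apply: mulr_ge0 | apply: sqr_ge0].
    - by rewrite invr_ge0 sqr_ge0.
    - apply: ler_wpM2r; first exact: sqr_ge0.
      by apply: ler_pM => //; rewrite ler_pM2l.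
    - by rewrite lef_pV2 ?posrE ?exprn_gt0 // ler_sqr ?nnegrE // (ltW N0).
  have -> : n%:R * (24 * E * r%:R * (kappa * alpha) ^+ 2 / r%:R ^+ 2) = d%:R * r%:R / 48.
    by rewrite /E; field; rewrite !gt_eqF.
  lra.
apply: (@le_trans _ _ (D * d%:R / (48 * r%:R))); last first.
  have -> : D * d%:R / (48 * r%:R) = D / (2 * r%:R) ^+ 2 * (d%:R * r%:R / 6) / 2.
    by field; rewrite gt_eqF.
  apply: ler_wpM2r; first by [].
  apply: ler_pM.
  - by rewrite divr_ge0 ?sqr_ge0 // ltW.
  - by rewrite divr_ge0 // mulr_ge0 // ltW.
  - have r2 : 0 < 2 * r%:R :> R by rewrite mulr_gt0.
    rewrite ler_pM2l // lef_pV2 ?posrE ?exprn_gt0 //.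
    by rewrite ler_sqr ?nnegrE // (ltW N0).
  - by lra.
have c0 : 0 < 48 * (24 * 48) * kappa ^+ 2 by rewrite !mulr_gt0.
have [h|h] := leP (1 / d%:R) E.
  have -> : D = 1 / d%:R by rewrite DE min_l.
  have -> : 1 / d%:R * d%:R / (48 * r%:R) = 1 / 48 * (1 / r%:R) :> R.
    by field; rewrite !gt_eqF.
  apply: (@le_trans _ _ (1 / (48 * (24 * 48) * kappa ^+ 2) * (1 / r%:R))).
    by rewrite ler_wpM2l ?divr_ge0 ?(ltW c0) // ge_min rate_cap_le ?r0.
  apply: ler_wpM2r; first by rewrite divr_ge0 // ltW.
  rewrite !div1r lef_pV2 ?posrE //; have := exprn_ege1 2 k1; lra.
have -> : D = E by rewrite DE min_r // ltW.
have -> : E * d%:R / (48 * r%:R) =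
    1 / (48 * (24 * 48) * kappa ^+ 2) * (d%:R ^+ 2 * r%:R / (n%:R * alpha ^+ 2)).
  by rewrite /E; field; rewrite !gt_eqF.
apply: ler_wpM2l; first by rewrite divr_ge0 // ltW.
by rewrite ge_min lexx orbT.
Qed.
End Rate.

Theorem theorem10 (R : realType) (c0 : R) (hc0 : 0 < c0 < 1 / 2) :
  exists c : R, 0 < c /\
    forall (n d r : nat) (alpha : R),
      (1 <= n)%N -> (2 <= d)%N -> (1 <= r <= d)%N ->
      0 < alpha <= 1 / 2 - c0 ->
      ((c * Num.min (rate_cap R d r)
              (d%:R ^+ 2 * r%:R / (n%:R * alpha ^+ 2)))%:E
        <= minimax_risk n d r alpha)%E.
Proof.
have /andP[c00 _] := hc0.
set kappa := 2 * (1 + 1 / c0) ^+ 2.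
have k1 : 1 <= kappa.
  have h : 0 < 1 / c0 by rewrite divr_gt0.
  have : 1 <= (1 + 1 / c0) ^+ 2 by rewrite exprn_ege1 // lerDl ltW.
  rewrite /kappa; lra.
exists (1 / (48 * (24 * 48) * kappa ^+ 2)); split.
  by rewrite divr_gt0 // mulr_gt0 // exprn_gt0 // (lt_le_trans _ k1).
move=> n d r alpha n0 d2 r1d /andP[a0 ac].
have /andP[r0 rd] := r1d.
apply: le_ereal_inf_tmp => _ [M [est [gM _ ->]]].
pose D : R := Num.min (1 / d%:R)
  (d%:R * r%:R ^+ 2 / (24 * 48 * kappa ^+ 2 * n%:R * alpha ^+ 2)).
have D0 : 0 <= D.
  rewrite le_min; apply/andP; split; first by rewrite divr_ge0.
  apply: divr_ge0; first by apply: mulr_ge0; last exact: sqr_ge0.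
  apply: mulr_ge0; last exact: sqr_ge0.
  by apply: mulr_ge0 => //; apply: mulr_ge0; last exact: sqr_ge0.
have sqD : Num.sqrt D ^+ 2 = D by rewrite sqr_sqrtr.
have [small rate] := frame_rate n0 d2 r1d k1 a0 (erefl D).
have mr : (minn r d./2 <= r)%N by apply: geq_minl.
have Dd : Num.sqrt D ^+ 2 * d%:R <= 1.
  by rewrite sqD -ler_pdivlMr ?ge_min ?lexx // ltr0n (leq_trans _ d2).
have a0c : 0 <= alpha <= 1 / 2 - c0 by rewrite ltW.
rewrite -sqD in small rate.
have [rho rho_r risk_rho] := exists_hard_state est n0 mr rd r0 Dd c00 a0c gM small.
apply: (@le_trans _ _ (risk est rho)); last by apply: ereal_sup_ubound; exists rho.
apply: le_trans risk_rho; rewrite lee_fin; apply: le_trans rate _.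
by rewrite expr_div_n.
Qed.
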